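(* Let $H$ be a local Hamiltonian on $n$ qubits, $\beta>0$, $\rho=e^{-\beta H}/\mathrm{Tr}[e^{-\beta H}]$, let $\mathsf A\subset[n]$ with complement $\bar{\mathsf A}$, and let $\sigma$ be a state. Suppose there is a quantum channel $\mathcal R$ and $\epsilon_{\mathsf{Markov}}>0$ with $$\|\mathcal R[\sigma_{\bar{\mathsf A}}\otimes\sigma_{\mathsf A}]-\sigma\|_1\le\epsilon_{\mathsf{Markov}}\qquad\text{and}\qquad\mathcal R[\rho]=\rho.$$ Then $$\mathsf I(\mathsf A:\bar{\mathsf A})_\sigma\le2\beta\|\partial H\|+4\,\epsilon_{\mathsf{Markov}}\cdot\max\Big(\log\frac1{\epsilon_{\mathsf{Markov}}},\ \beta\|H\|,\ n\Big).$$
   Context: $H=\sum_\gamma H_\gamma$ is a sum of Hermitian terms each acting on a subset of the qubits, and $\partial H$ is the sum of the terms $H_\gamma$ whose support intersects both $\mathsf A$ and $\bar{\mathsf A}$. $\sigma_{\mathsf A},\sigma_{\bar{\mathsf A}}$ are the marginals of $\sigma$. $\mathsf I(\mathsf A:\bar{\mathsf A})_\sigma=S(\sigma_{\mathsf A})+S(\sigma_{\bar{\mathsf A}})-S(\sigma)$ with $S(\sigma)=-\mathrm{Tr}[\sigma\log\sigma]$ (natural logarithm). $\|\cdot\|$ is the operator norm and $\|\cdot\|_1$ the trace norm. *)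

(* Defs.v *)
From HB Require Import structures.
From mathcomp Require Import all_boot all_order all_algebra.
From mathcomp Require Import complex sesquilinear spectral.
From mathcomp Require Import all_classical all_reals all_analysis.

Set Implicit Arguments.
Unset Strict Implicit.
Unset Printing Implicit Defensive.

Import Order.TTheory GRing.Theory Num.Theory.
Local Open Scope ring_scope.
Local Open Scope complex_scope.
Local Open Scope sesquilinear_scope.

(* Matrices act on column vectors, and M ^t* is the conjugate transpose. *)

Section Matrices.
Context {R : realType}.

(* f(M) for a Hermitian M: f is applied to the eigenvalues in the spectral
   decomposition M = P^-1 diag(lambda) P. It is only used for Hermitian M; it
   then does not depend on the eigenbasis chosen by [spectralmx]. *)
Definition mxfun d (f : R -> R) (M : 'M[R[i]]_d) : 'M[R[i]]_d :=
  invmx (spectralmx M)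
  *m diag_mx (map_mx (fun z => (f (complex.Re z))%:C) (spectral_diag M))
  *m spectralmx M.

Definition vnorm d (v : 'cV[R[i]]_d) : R :=
  Num.sqrt (complex.Re ((v ^t* *m v) 0 0)).

Definition opnorm d (M : 'M[R[i]]_d) : R :=
  sup [set vnorm (M *m v) | v in [set v : 'cV[R[i]]_d | vnorm v <= 1]]%classic.

(* Tr sqrt(M^* M) *)
Definition trnorm d (M : 'M[R[i]]_d) : R :=
  complex.Re (\tr (mxfun Num.sqrt (M ^t* *m M))).

(* [0 <= z] in R[i] means that z is real and nonnegative, so M is Hermitian. *)
Definition psdmx d (M : 'M[R[i]]_d) : Prop :=
  forall v : 'cV[R[i]]_d, 0 <= (v ^t* *m M *m v) 0 0.

Definition state d (M : 'M[R[i]]_d) : Prop := psdmx M /\ \tr M = 1.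

(* Since ln 0 = 0 here, eigenvalues 0 contribute 0 log 0 = 0. *)
Definition entropy d (M : 'M[R[i]]_d) : R :=
  - complex.Re (\tr (M *m mxfun (@ln R) M)).

Definition gibbs d (beta : R) (H : 'M[R[i]]_d) : 'M[R[i]]_d :=
  let E := mxfun expR ((- beta)%:C *: H) in (\tr E)^-1 *: E.

(* id_k (x) Phi, acting blockwise on k x k block matrices. *)
Definition ampliation d (k : nat) (Phi : 'M[R[i]]_d -> 'M[R[i]]_d)
    (M : 'M[R[i]]_(\sum_(i < k) d)) : 'M[R[i]]_(\sum_(i < k) d) :=
  \mxblock_(i < k, j < k) Phi (submxblock M i j).

Definition completely_positive d (Phi : 'M[R[i]]_d -> 'M[R[i]]_d) : Prop :=
  forall (k : nat) (M : 'M[R[i]]_(\sum_(i < k) d)),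
    psdmx M -> psdmx (ampliation Phi M).

Definition channel d (Phi : {linear 'M[R[i]]_d -> 'M[R[i]]_d}) : Prop :=
  completely_positive Phi /\ forall M, \tr (Phi M) = \tr M.

End Matrices.

(* Operators on the qubits labelled by a finite type T: rows and columns are
   indexed, through [enum_val], by the computational basis {ffun T -> bool}. *)
Notation op R T := 'M[R[i]]_#|{ffun T -> bool}|.
Notation qubits A := {j | j \in A}.

Definition restrict n (A : {set 'I_n}) (x : 'I_#|{ffun 'I_n -> bool}|) :
    'I_#|{ffun qubits A -> bool}| :=
  enum_rank [ffun j : qubits A => enum_val x (val j)].

Section Qubits.
Context {R : realType} {n : nat}.

(* X on A tensored with Y on the complement, as an operator on all n qubits;
   the factors are placed by their qubit labels, so their order is
   immaterial. *)
Definition tensor (A : {set 'I_n}) (X : op R (qubits A))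
    (Y : op R (qubits (~: A))) : op R 'I_n :=
  \matrix_(x, y) (X (restrict A x) (restrict A y)
                  * Y (restrict (~: A) x) (restrict (~: A) y)).

(* Partial trace over the complement of A: the (a, b) entry sums M x y over
   the x extending a and the y extending b that agree outside A. *)
Definition marginal (A : {set 'I_n}) (M : op R 'I_n) : op R (qubits A) :=
  \matrix_(a, b)
    \sum_x \sum_(y | [&& restrict A x == a, restrict A y == b
                       & restrict (~: A) x == restrict (~: A) y]) M x y.

Definition acts_on (A : {set 'I_n}) (M : op R 'I_n) : Prop :=
  exists X : op R (qubits A), M = tensor X 1%:M.

Definition mutual_info (A : {set 'I_n}) (M : op R 'I_n) : R :=
  entropy (marginal A M) + entropy (marginal (~: A) M) - entropy M.

(* A Hamiltonian is given by its terms h g, each with its support supp g. *)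
Definition local_terms (G : finType) (supp : G -> {set 'I_n})
    (h : G -> op R 'I_n) : Prop :=
  forall g, h g \is hermsymmx /\ acts_on (supp g) (h g).

Definition hamiltonian (G : finType) (h : G -> op R 'I_n) : op R 'I_n :=
  \sum_g h g.

Definition boundary (G : finType) (supp : G -> {set 'I_n})
    (h : G -> op R 'I_n) (A : {set 'I_n}) : op R 'I_n :=
  \sum_(g | (supp g :&: A != finset.set0) && (supp g :&: ~: A != finset.set0)) h g.

End Qubits.

(* Main.v *)
(* Write tau for the product of the two marginals of sigma, and
   D(x || rho) = - S(x) + beta Tr[x H] + log Z. As H - dH cannot tell tau from
   sigma,
     I(A : A^c) = S(tau) - S(sigma)
                = beta Tr[dH (tau - sigma)] + D(sigma || rho) - D(tau || rho).
   The first term is at most 2 beta |dH|. By data processing and R[rho] = rho,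
   D(tau || rho) >= D(R[tau] || rho), so the rest is at most
   beta Tr[H (sigma - R[tau])] + S(R[tau]) - S(sigma), which is controlled by
   Hoelder's inequality and by continuity of the entropy.

   Data processing: p (log p - log q) is an integral over t >= 0 of terms
   p^2 / (q + t p), and the matching quantum form <M, (L_N + t R_M)^-1 M> is a
   supremum of quadratic functionals, each of which is monotone under a
   2-positive map by the Schwarz inequality for the dual map. *)

Require Import Defs.
From HB Require Import structures.
From mathcomp Require Import all_boot all_order all_algebra.
From mathcomp Require Import complex sesquilinear spectral.
From mathcomp Require Import all_classical all_reals all_analysis.
From mathcomp Require Import ring lra.

Set Implicit Arguments.
Unset Strict Implicit.
Unset Printing Implicit Defensive.

Import Order.TTheory GRing.Theory Num.Theory.
Local Open Scope ring_scope.
Local Open Scope complex_scope.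

(** * Spectral decompositions *)

Section Spectral.
Context {R : realType}.
Local Notation C := R[i].

(** The squared modulus of [z], taken in [R] so that spectral sums stay real. *)
Definition sqn (z : C) : R := complex.Re z ^+ 2 + complex.Im z ^+ 2.

Lemma mul_conj_sqn (z : C) : (z^*)%C * z = (sqn z)%:C.
Proof.
by case: z => a b; apply/eqP; rewrite eq_complex /= /sqn /=; apply/andP; split;
   apply/eqP; ring.
Qed.

Lemma sqn_ge0 z : 0 <= sqn z.
Proof. by rewrite addr_ge0 ?sqr_ge0. Qed.

Lemma ReD (x y : C) : complex.Re (x + y) = complex.Re x + complex.Re y.
Proof. by case: x y => [? ?] [? ?]. Qed.

Lemma Re_sum (I : Type) (r : seq I) (P : pred I) (F : I -> C) :
  complex.Re (\sum_(i <- r | P i) F i) = \sum_(i <- r | P i) complex.Re (F i).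
Proof. by apply: (big_morph _ ReD). Qed.

Lemma ReN (x : C) : complex.Re (- x) = - complex.Re x.
Proof. by case: x. Qed.

Lemma ReB (x y : C) : complex.Re (x - y) = complex.Re x - complex.Re y.
Proof. by rewrite ReD ReN. Qed.

Lemma Re_realM (r : R) (x : C) : complex.Re (r%:C * x) = r * complex.Re x.
Proof. by case: x => a b /=; ring. Qed.

Lemma Re_conj (x : C) : complex.Re x^* = complex.Re x.
Proof. by case: x. Qed.

(** * Adjoints and unitary matrices *)

Fact adjmx_key : unit. Proof. exact: tt. Qed.

(* Sealed, because unification otherwise unfolds conjugation on R[i]. *)
Definition adjmx m n (A : 'M[C]_(m, n)) : 'M[C]_(n, m) :=
  locked_with adjmx_key (A ^t*)%sesqui.

Local Notation "A ^H" := (adjmx A) (at level 8, format "A ^H").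

Lemma adjmxE m n (A : 'M[C]_(m, n)) : A^H = (A ^t*)%sesqui.
Proof. by rewrite /adjmx unlock. Qed.

Lemma adjmxEij m n (A : 'M[C]_(m, n)) i j : A^H i j = ((A j i)^*)%C.
Proof. by rewrite adjmxE !mxE. Qed.

Lemma adjmxK m n (A : 'M[C]_(m, n)) : A^H^H = A.
Proof. by apply/matrixP=> i j; rewrite !adjmxEij conjcK. Qed.

Lemma adjmxM m n p (A : 'M[C]_(m, n)) (B : 'M[C]_(n, p)) :
  (A *m B)^H = B^H *m A^H.
Proof. by rewrite !adjmxE trmx_mul map_mxM. Qed.

Lemma adjmxD m n (A B : 'M[C]_(m, n)) : (A + B)^H = A^H + B^H.
Proof. by apply/matrixP=> i j; rewrite mxE !adjmxEij mxE rmorphD. Qed.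

Lemma adjmxN m n (A : 'M[C]_(m, n)) : (- A)^H = - A^H.
Proof. by apply/matrixP=> i j; rewrite mxE !adjmxEij mxE rmorphN. Qed.

Lemma adjmx1 d : (1%:M : 'M[C]_d)^H = 1%:M.
Proof. by rewrite adjmxE trmx1 map_mx1. Qed.

Lemma mxtrace_adj d (A : 'M[C]_d) : \tr (A^H) = ((\tr A)^*)%C.
Proof. by rewrite /mxtrace rmorph_sum; apply: eq_bigr => i _; rewrite adjmxEij. Qed.

Definition unitary d (U : 'M[C]_d) : Prop := U *m U^H = 1%:M /\ U^H *m U = 1%:M.

Lemma unitary_adj d (U : 'M[C]_d) : unitary U -> unitary U^H.
Proof. by case=> h1 h2; split; rewrite adjmxK. Qed.

Lemma unitary1 d : unitary (1%:M : 'M[C]_d).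
Proof. by split; rewrite adjmx1 mulmx1. Qed.

Lemma unitarymx_unitary d (U : 'M[C]_d) : U \is unitarymx -> unitary U.
Proof.
move=> u; split; rewrite adjmxE; first by apply/unitarymxP.
have /unitarymxP : (U ^t*)%sesqui \is unitarymx by rewrite trmxC_unitary.
by rewrite trmxCK.
Qed.

(** * Real diagonal matrices and eigendecompositions *)

Definition rdiag d (l : 'I_d -> R) : 'M[C]_d := diag_mx (\row_j (l j)%:C).

Lemma rdiagE d (l : 'I_d -> R) i j : rdiag l i j = (l i)%:C *+ (i == j).
Proof. by rewrite !mxE. Qed.

Lemma mul_rdiagl m n (l : 'I_m -> R) (A : 'M[C]_(m, n)) i j :
  (rdiag l *m A) i j = (l i)%:C * A i j.
Proof. by rewrite mul_diag_mx !mxE. Qed.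

Lemma mul_rdiagr m n (l : 'I_n -> R) (A : 'M[C]_(m, n)) i j :
  (A *m rdiag l) i j = A i j * (l j)%:C.
Proof. by rewrite mul_mx_diag !mxE. Qed.

Lemma rdiag_adj d (l : 'I_d -> R) : (rdiag l)^H = rdiag l.
Proof.
apply/matrixP=> i j; rewrite adjmxEij !rdiagE eq_sym; case: eqP => [->|_].
  by rewrite !mulr1n conjc_real.
by rewrite !mulr0n rmorph0.
Qed.

Lemma rdiagM d (l m : 'I_d -> R) :
  rdiag l *m rdiag m = rdiag (fun j => l j * m j).
Proof.
apply/matrixP=> i j; rewrite mul_rdiagl !rdiagE rmorphM.
by case: eqP => [->|_]; rewrite ?mulr1n ?mulr0n ?mulr0.
Qed.

(** Any eigenbasis (the columns of [U]) and any order of the eigenvalues is allowed, so bases can be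
    chosen freely; real [l] makes [M] Hermitian. *)
Definition eigdec d (U : 'M[C]_d) (l : 'I_d -> R) (M : 'M[C]_d) : Prop :=
  unitary U /\ M = U *m rdiag l *m U^H.

Lemma eigdec_herm d (U : 'M[C]_d) l M : eigdec U l M -> M^H = M.
Proof. by case=> _ ->; rewrite !adjmxM adjmxK rdiag_adj mulmxA. Qed.

Lemma spectral_eigdec d (M : 'M[C]_d) : M^H = M ->
  eigdec (spectralmx M)^H (fun j => complex.Re (spectral_diag M 0 j)) M.
Proof.
move=> hM; have Mh : M \is hermsymmx.
  by rewrite qualifE /= expr0 scale1r -[X in _ == X]adjmxE hM.
have Mn : M \is normalmx by apply: hermitian_normalmx.
split; first by apply: unitary_adj; apply: unitarymx_unitary;
  exact: spectral_unitarymx.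
have E := orthomx_spectralP Mn; rewrite adjmxK.
have D : diag_mx (spectral_diag M) =
    rdiag (fun j => complex.Re (spectral_diag M 0 j)).
  congr diag_mx; apply/rowP=> i; rewrite mxE.
  by have /mxOverP /(_ 0 i) /RRe_real -> := hermitian_spectral_diag_real Mh.
rewrite -D.
have -> : (spectralmx M)^H = invmx (spectralmx M).
  by rewrite adjmxE; apply/esym/invmx_unitary; exact: spectral_unitarymx.
exact: E.
Qed.

Lemma herm_eigdec d (M : 'M[C]_d) : M^H = M -> exists U l, eigdec U l M.
Proof. by move=> /spectral_eigdec h; eexists; eexists; exact: h. Qed.

(** Conjugation by [V^H] on the left and [U] on the right turns the equality into an intertwining
    relation for the transition matrix [V^H *m U]. *)
Lemma eigdec_intertwine d (U V : 'M[C]_d) l m : unitary U -> unitary V ->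
  U *m rdiag l *m U^H = V *m rdiag m *m V^H <->
  rdiag m *m (V^H *m U) = (V^H *m U) *m rdiag l.
Proof.
move=> [U1 U2] [V1 V2]; split=> E.
  have := congr1 (fun X => V^H *m X *m U) E.
  rewrite (mulmxA V^H _ V^H) (mulmxA V^H V) V2 mul1mx -(mulmxA _ V^H U) => <-.
  by rewrite (mulmxA V^H _ U^H) -(mulmxA _ U^H U) U2 mulmx1 mulmxA.
have := congr1 (fun X => V *m X *m U^H) E.
rewrite -(mulmxA V^H U) (mulmxA V V^H) V1 mul1mx => <-.
by rewrite -(mulmxA V) -(mulmxA _ _ U^H) -(mulmxA V^H) U1 mulmx1 mulmxA.
Qed.

(** Entrywise the intertwining relation reads [m i * W i j = W i j * l j]: where [W i j] is nonzero
    the eigenvalues agree, hence so do their images under [f]. *)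
Lemma eigdec_fun_uniq d (f : R -> R) (U V : 'M[C]_d) l m M :
  eigdec U l M -> eigdec V m M ->
  U *m rdiag (f \o l) *m U^H = V *m rdiag (f \o m) *m V^H.
Proof.
move=> [Uu ->] [Vu E]; apply/eigdec_intertwine => //.
move/(eigdec_intertwine l m Uu Vu): E; set W := V^H *m U => E.
apply/matrixP=> i j; move/matrixP: E => /(_ i j).
rewrite !mul_rdiagl !mul_rdiagr /=; have [->|w0] := eqVneq (W i j) 0.
  by rewrite !mulr0 !mul0r.
rewrite mulrC => /(mulfI w0) /complexI ->; exact: mulrC.
Qed.

Lemma eigdec_mxfun d (f : R -> R) (U : 'M[C]_d) l M :
  eigdec U l M -> eigdec U (f \o l) (mxfun f M).
Proof.
move=> e; split; first by case: e.
rewrite (eigdec_fun_uniq f e (spectral_eigdec (eigdec_herm e))) adjmxK.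
have -> : (spectralmx M)^H = invmx (spectralmx M).
  by rewrite adjmxE; apply/esym/invmx_unitary; exact: spectral_unitarymx.
congr (_ *m diag_mx _ *m _); apply/matrixP=> i j; by rewrite !mxE ord1.
Qed.

(** * Traces and overlaps of eigenbases *)

Lemma trace_eigdec d (U : 'M[C]_d) p M K : eigdec U p M ->
  \tr (M *m K) = \sum_j (p j)%:C * (U^H *m K *m U) j j.
Proof.
case=> _ ->; rewrite -(mulmxA _ _ K) -(mulmxA U) mxtrace_mulC -(mulmxA (rdiag p)).
by rewrite /mxtrace; apply: eq_bigr => j _; rewrite mul_rdiagl.
Qed.

Lemma trace_eigdecE d (U : 'M[C]_d) p M : eigdec U p M ->
  \tr M = (\sum_j p j)%:C.
Proof.
move=> e; rewrite -[M]mulmx1 (trace_eigdec _ e) rmorph_sum.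
apply: eq_bigr => j _; rewrite mulmx1 (e.1).2.
by rewrite mxE eqxx mulr1.
Qed.

(** Transition probabilities |<v_k, u_j>|^2 between two bases. For unitary [U] and [V] they form a
    doubly stochastic matrix, which turns traces of products into classical double sums. *)
Definition overlap d (V U : 'M[C]_d) (k j : 'I_d) : R := sqn ((V^H *m U) k j).

Lemma overlap_ge0 d (V U : 'M[C]_d) k j : 0 <= overlap V U k j.
Proof. exact: sqn_ge0. Qed.

Lemma conj_eigdec_diag d (U V : 'M[C]_d) g K j : eigdec V g K ->
  (U^H *m K *m U) j j = (\sum_k g k * overlap V U k j)%:C.
Proof.
case=> _ ->; rewrite (mulmxA U^H _ V^H) (mulmxA U^H V) -(mulmxA _ V^H U).
have -> : U^H *m V = (V^H *m U)^H by rewrite adjmxM adjmxK.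
rewrite /overlap; set W := V^H *m U.
rewrite -(mulmxA W^H) mxE rmorph_sum; apply: eq_bigr => k _.
by rewrite mul_rdiagl adjmxEij mulrCA mul_conj_sqn rmorphM.
Qed.

(** The identity has all eigenvalues 1 in the basis [V], so the sum is a diagonal entry of
    [U^H *m U]. *)
Lemma overlap_suml d (V U : 'M[C]_d) j : unitary V -> unitary U ->
  \sum_k overlap V U k j = 1.
Proof.
move=> Vu Uu; apply/complexI.
have e : eigdec V (fun=> 1) 1%:M.
  split=> //; have -> : rdiag (fun=> 1 : R) = 1%:M :> 'M[C]_d.
    by apply/matrixP=> a b; rewrite rdiagE mxE.
  by rewrite mulmx1 Vu.1.
have := conj_eigdec_diag U j e; rewrite mulmx1 Uu.2 mxE eqxx.
move=> E; apply: etrans (esym E).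
by congr (_%:C); apply: eq_bigr => k _; rewrite mul1r.
Qed.

Lemma overlapC d (V U : 'M[C]_d) k j : overlap V U k j = overlap U V j k.
Proof.
rewrite /overlap; have -> : U^H *m V = (V^H *m U)^H by rewrite adjmxM adjmxK.
by rewrite adjmxEij /sqn; case: (_ k j) => a b /=; rewrite sqrrN.
Qed.

Lemma overlap_sumr d (V U : 'M[C]_d) k : unitary V -> unitary U ->
  \sum_j overlap V U k j = 1.
Proof.
move=> Vu Uu; rewrite -(overlap_suml k Uu Vu).
by apply: eq_bigr => j _; rewrite overlapC.
Qed.

Lemma overlap_self d (U : 'M[C]_d) k j : unitary U ->
  overlap U U k j = (k == j)%:R.
Proof.
move=> Uu; rewrite /overlap Uu.2 mxE /sqn.
by case: (k == j) => /=; rewrite ?expr1n expr0n addr0.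
Qed.

Lemma Re_trace_overlap d (U V : 'M[C]_d) p g M K :
  eigdec U p M -> eigdec V g K ->
  complex.Re (\tr (M *m K)) = \sum_j \sum_k p j * g k * overlap V U k j.
Proof.
move=> eM eK; rewrite (trace_eigdec _ eM) Re_sum; apply: eq_bigr => j _.
rewrite Re_realM (conj_eigdec_diag U j eK) mulr_sumr.
by apply: eq_bigr => k _; rewrite mulrA.
Qed.

Lemma Re_trace_self d (U : 'M[C]_d) p g M K :
  eigdec U p M -> eigdec U g K ->
  complex.Re (\tr (M *m K)) = \sum_j p j * g j.
Proof.
move=> eM eK; rewrite (Re_trace_overlap eM eK); apply: eq_bigr => j _.
rewrite (bigD1 j) //= overlap_self; last by case: eM.
rewrite eqxx mulr1 big1 ?addr0 // => k /negPf kj.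
by rewrite overlap_self ?kj ?mulr0 //; case: eM.
Qed.

Lemma entropy_eigdec d (U : 'M[C]_d) p M : eigdec U p M ->
  entropy M = - \sum_j p j * ln (p j).
Proof.
by move=> e; rewrite /entropy (Re_trace_self e (eigdec_mxfun (@ln R) e)).
Qed.

Lemma trnorm_eigdec d (U : 'M[C]_d) p M : eigdec U p M ->
  trnorm M = \sum_j `|p j|.
Proof.
move=> e; rewrite /trnorm.
(* For Hermitian [M] the matrix under the square root is the square of [M], diagonal in the same
   basis. *)
have e2 : eigdec U (fun j => p j ^+ 2) (M *m M).
  case: (e) => Uu ->; split=> //.
  rewrite !mulmxA -(mulmxA _ U^H U) Uu.2 mulmx1 -(mulmxA U) rdiagM.
  by congr (_ *m diag_mx _ *m _); apply/rowP=> i; rewrite !mxE expr2.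
have -> : (M ^t*)%sesqui *m M = M *m M by rewrite -adjmxE (eigdec_herm e).
rewrite (trace_eigdecE (eigdec_mxfun Num.sqrt e2)).
by apply: eq_bigr => j _; rewrite /= sqrtr_sqr.
Qed.

(** * Positive semidefinite matrices *)

Lemma psdmxE d (M : 'M[C]_d) :
  psdmx M <-> forall v : 'cV[C]_d, 0 <= (v^H *m M *m v) 0 0.
Proof. by split=> h v; have := h v; rewrite adjmxE. Qed.

Lemma psdmx_congr m d (A : 'M[C]_(m, d)) (M : 'M[C]_d) :
  psdmx M -> psdmx (A *m M *m A^H).
Proof.
move=> /psdmxE h; apply/psdmxE => v; have := h (A^H *m v).
by rewrite adjmxM adjmxK !mulmxA.
Qed.

Lemma psdmxD d (M N : 'M[C]_d) : psdmx M -> psdmx N -> psdmx (M + N).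
Proof.
move=> /psdmxE hM /psdmxE hN; apply/psdmxE => v.
by rewrite mulmxDr mulmxDl mxE addr_ge0.
Qed.

Lemma psdmx0 d : psdmx (0 : 'M[C]_d).
Proof. by apply/psdmxE=> v; rewrite mulmx0 mul0mx mxE. Qed.

Lemma psdmx_sum d (I : Type) (r : seq I) (F : I -> 'M[C]_d) :
  (forall i, psdmx (F i)) -> psdmx (\sum_(i <- r) F i).
Proof.
move=> h.
exact: (big_ind (fun X => psdmx X) (@psdmx0 d) (@psdmxD d) (fun i _ => h i)).
Qed.

Lemma quadmxD d (N : 'M[C]_d) (v w : 'cV[C]_d) :
  ((v + w)^H *m N *m (v + w)) 0 0 =
  (v^H *m N *m v) 0 0 + (w^H *m N *m w) 0 0 +
  ((v^H *m N *m w) 0 0 + (w^H *m N *m v) 0 0).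
Proof.
have E (X Y : 'M[C]_1) : (X + Y) 0 0 = X 0 0 + Y 0 0 by rewrite mxE.
rewrite adjmxD mulmxDr !(mulmxDl v^H) !(mulmxDl (v^H *m N)) !E.
by rewrite -!addrA; congr (_ + _); rewrite addrC addrAC addrC.
Qed.

Lemma bilin_delta d (N : 'M[C]_d) i j (a b : C) :
  ((a *: (delta_mx i 0 : 'cV_d))^H *m N *m (b *: (delta_mx j 0 : 'cV_d))) 0 0
  = (a^*)%C * b * N i j.
Proof.
have -> : (a *: (delta_mx i 0 : 'cV_d))^H = (a^*)%C *: delta_mx 0 i :> 'rV[C]_d.
  by apply/matrixP=> x y; rewrite adjmxEij !mxE rmorphM rmorph_nat andbC.
by rewrite -scalemxAr -2!scalemxAl -rowE -colE !mxE mulrA [b * _]mulrC.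
Qed.

Lemma quadmx_delta d (N : 'M[C]_d) i j (b : C) :
  ((1 *: (delta_mx i 0 : 'cV_d) + b *: (delta_mx j 0 : 'cV_d))^H *m N
    *m (1 *: (delta_mx i 0 : 'cV_d) + b *: (delta_mx j 0 : 'cV_d))) 0 0
  = N i i + ((b^*)%C * b * N j j) + (b * N i j + (b^*)%C * N j i).
Proof.
apply: (etrans (quadmxD _ _ _)); congr (_ + _ + (_ + _)).
- by rewrite bilin_delta conjc1 !mul1r.
- by rewrite bilin_delta.
- by rewrite bilin_delta conjc1 mul1r.
- by rewrite bilin_delta mulr1.
Qed.

Lemma psdmx_diag_ge0 d (M : 'M[C]_d) i : psdmx M -> 0 <= M i i.
Proof.
move=> /psdmxE /(_ (1 *: delta_mx i 0)).
by rewrite bilin_delta conjc1 !mul1r.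
Qed.

Lemma psdmx_trace_ge0 d (M : 'M[C]_d) : psdmx M -> 0 <= complex.Re (\tr M).
Proof.
move=> h; rewrite /mxtrace Re_sum sumr_ge0 // => i _.
by have := psdmx_diag_ge0 i h; rewrite lecE => /andP[].
Qed.

(* Polarization with v = e_i + e_j and v = e_i + i e_j. *)
Lemma psdmx_herm d (M : 'M[C]_d) : psdmx M -> M^H = M.
Proof.
move=> h; apply/matrixP=> j i; rewrite adjmxEij.
have h1 k : complex.Im (M k k) = 0 by apply: ger0_Im; apply: psdmx_diag_ge0.
have h2 (b : C) : complex.Im (b * M i j + (b^*)%C * M j i) = 0.
  have : complex.Im (M i i + ((b^*)%C * b * M j j) +
      (b * M i j + (b^*)%C * M j i)) = 0.
    have /psdmxE/(_ (1 *: delta_mx i 0 + b *: delta_mx j 0)) := h.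
    by rewrite quadmx_delta => /ger0_Im.
  move: (h1 i) (h1 j); case: (M i i) (M j j) (M i j) (M j i) b.
  by move=> a1 a2 [b1 b2] [c1 c2] [e1 e2] [f1 f2] /= -> ->; lra.
have e1 := h2 1; have e2 := h2 'i%C; apply/eqP.
move: e1 e2; case: (M i j) (M j i) => [a b] [c e] /= e1 e2.
by rewrite eq_complex /=; apply/andP; split; apply/eqP; lra.
Qed.

Lemma psdmx_eigdec d (M : 'M[C]_d) : psdmx M ->
  exists U p, eigdec U p M /\ forall j, 0 <= p j.
Proof.
move=> h; have [U [p e]] := herm_eigdec (psdmx_herm h).
exists U, p; split=> // j.
(* The eigenvalue [p j] is a diagonal entry of [U^H *m M *m U], which is again positive
   semidefinite. *)
have := psdmx_diag_ge0 j (psdmx_congr (U^H) h).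
rewrite adjmxK (conj_eigdec_diag U j e) ler0c.
have Uu : unitary U by case: e.
rewrite (bigD1 j) //= overlap_self // eqxx mulr1 big1 ?addr0 // => k /negPf kj.
by rewrite overlap_self // kj mulr0.
Qed.

Lemma eigdec_psd d (U : 'M[C]_d) p M : eigdec U p M ->
  (forall j, 0 <= p j) -> psdmx M.
Proof.
move=> [_ ->] p0; apply: psdmx_congr; apply/psdmxE => v.
rewrite -mulmxA mxE sumr_ge0 // => j _; rewrite mul_rdiagl adjmxEij mulrCA.
by rewrite mul_conj_sqn mulr_ge0 ?ler0c ?sqn_ge0.
Qed.

End Spectral.

Notation "A ^H" := (adjmx A) (at level 8, format "A ^H").

(** * Quadratic functionals under channels *)

Lemma sum_ord2 (V : nmodType) (F : 'I_2 -> V) :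
  \sum_(i < 2) F i = F ord0 + F (lift ord0 ord0).
Proof. by rewrite 2!big_ord_recl big_ord0 addr0. Qed.

Lemma mxtraceN (K : pzRingType) d (A : 'M[K]_d) : \tr (- A) = - \tr A.
Proof. exact: raddfN. Qed.

(** The two sign conditions are [b <= a] and [v <= u], in the unsimplified shape in which the
    Schwarz inequality supplies them. *)
Lemma quadJ_arith (R : realFieldType) (a b s t u v : R) : 0 <= t ->
  0 <= a + - b *+ 2 + b -> 0 <= u + - v *+ 2 + v ->
  s - a - t * u <= s - b - t * v.
Proof.
move=> t0 ab uv; have : t * v <= t * u by apply: ler_wpM2l => //; lra.
by lra.
Qed.

Section Channels.
Context {R : realType}.
Local Notation C := R[i].

(** * Completely positive maps on block matrices *)

Lemma adjmx_mxcol k m d (V : 'I_k -> 'M[C]_(d, m)) :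
  (\mxcol_(i < k) V i)^H = \mxrow_(j < k) (V j)^H.
Proof.
rewrite adjmxE tr_mxcol; apply/matrixP=> a b.
by rewrite !mxE adjmxEij.
Qed.

Lemma adjmx_mxblock k d (B : 'I_k -> 'I_k -> 'M[C]_d) :
  (\mxblock_(i < k, j < k) B i j)^H = \mxblock_(i < k, j < k) (B j i)^H.
Proof.
rewrite adjmxE tr_mxblock; apply/matrixP=> a b.
by rewrite !mxE adjmxEij.
Qed.

(** Before [Phi] acts, the block matrix is [C *m rho *m C^H] for the block column [C] of the [V i],
    hence positive; [ampliation] then applies [Phi] to every block. *)
Lemma cp_block_psd d (Phi : 'M[C]_d -> 'M[C]_d) k (V : 'I_k -> 'M[C]_d) rho :
  completely_positive Phi -> psdmx rho ->
  psdmx (\mxblock_(i < k, j < k) Phi (V i *m rho *m (V j)^H)).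
Proof.
move=> cpPhi hr.
have E : \mxblock_(i < k, j < k) (V i *m rho *m (V j)^H) =
    (\mxcol_i V i) *m rho *m (\mxcol_i V i)^H.
  by rewrite adjmx_mxcol mxcol_mul mul_mxcol_mxrow.
have := cpPhi k (\mxblock_(i < k, j < k) (V i *m rho *m (V j)^H)).
have -> : ampliation Phi (\mxblock_(i < k, j < k) (V i *m rho *m (V j)^H)) =
    \mxblock_(i < k, j < k) Phi (V i *m rho *m (V j)^H).
  by apply/eq_mxblockP => i j; rewrite mxblockK.
by apply; rewrite E; apply: psdmx_congr.
Qed.

Lemma psdmx1 d : psdmx (1%:M : 'M[C]_d).
Proof.
apply/psdmxE => v; rewrite mulmx1 mxE sumr_ge0 // => j _.
by rewrite adjmxEij mul_conj_sqn ler0c sqn_ge0.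
Qed.

(** The positive 2 x 2 block matrix built from the identity and V = (1, [M^H]) is Hermitian, and its
    off-diagonal blocks are [Phi M] and [Phi (M^H)]. *)
Lemma cp_adj d (Phi : 'M[C]_d -> 'M[C]_d) M :
  completely_positive Phi -> (Phi M)^H = Phi (M^H).
Proof.
move=> cpPhi.
have := psdmx_herm (cp_block_psd (fun i : 'I_2 => if i == 0 then 1%:M else M^H)
  cpPhi (@psdmx1 d)).
rewrite adjmx_mxblock => /(congr1 (fun N => submxblock N ord_max 0)).
by rewrite !mxblockK /= adjmxK adjmx1 !mulmx1 mul1mx.
Qed.

Lemma cp_quad_ge0 d m (Phi : 'M[C]_d -> 'M[C]_d) k (V : 'I_k -> 'M[C]_d)
    (W : 'I_k -> 'M[C]_(d, m)) rho :
  completely_positive Phi -> psdmx rho ->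
  psdmx (\sum_(i < k) \sum_(j < k)
     (W i)^H *m Phi (V i *m rho *m (V j)^H) *m W j).
Proof.
move=> cpPhi hr.
have := psdmx_congr (\mxcol_i W i)^H (cp_block_psd V cpPhi hr).
rewrite adjmxK.
rewrite adjmx_mxcol mul_mxrow_mxblock mul_mxrow_mxcol.
rewrite exchange_big /=; congr psdmx; apply: eq_bigr => j _.
by rewrite mulmx_suml.
Qed.

Lemma cp_psd d (Phi : 'M[C]_d -> 'M[C]_d) rho :
  completely_positive Phi -> psdmx rho -> psdmx (Phi rho).
Proof.
move=> cpPhi hr.
have := cp_quad_ge0 (fun=> 1%:M : 'M[C]_d) (fun _ : 'I_1 => 1%:M : 'M[C]_d) cpPhi hr.
congr psdmx; rewrite big_ord1 big_ord1 /= adjmx1.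
rewrite (mul1mx (Phi _)) (mulmx1 (Phi _)); congr Phi.
by rewrite mul1mx (mulmx1 rho).
Qed.

(** The operator Schwarz inequality with the square left expanded: the families (1, [V]) and ([W],
    1) in [cp_quad_ge0]. *)
Lemma cp_schwarz d (Phi : 'M[C]_d -> 'M[C]_d) V W rho :
  completely_positive Phi -> psdmx rho ->
  psdmx (W^H *m Phi rho *m W + W^H *m Phi (rho *m V^H) +
         (Phi (V *m rho) *m W + Phi (V *m rho *m V^H))).
Proof.
move=> cpPhi hr; have := cp_quad_ge0 (fun i : 'I_2 => if i == 0 then 1%:M else V)
  (fun i => if i == 0 then W else 1%:M) cpPhi hr.
congr psdmx; rewrite sum_ord2 [X in X + _]sum_ord2 [X in _ + X]sum_ord2 /= adjmx1.
apply: f_equal2; apply: f_equal2.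
- by rewrite (mul1mx rho) (mulmx1 rho).
- by rewrite (mul1mx rho) (mulmx1 (_ *m _)).
- by rewrite (mulmx1 (_ *m rho)) (mul1mx (Phi _)).
- by rewrite (mul1mx (Phi _)) (mulmx1 (Phi _)).
Qed.

(** * The dual map and the quadratic functional *)

Lemma trace_dual d (Phi : {linear 'M[C]_d -> 'M[C]_d}) (X : 'M[C]_d) :
  exists Z : 'M[C]_d, forall M, \tr (X *m Phi M) = \tr (Z *m M).
Proof.
exists (\matrix_(i, j) \tr (X *m Phi (delta_mx j i))) => M.
have -> : \tr (X *m Phi M) = \sum_i \sum_j M i j * \tr (X *m Phi (delta_mx i j)).
  rewrite {1}[M]matrix_sum_delta linear_sum mulmx_sumr linear_sum.
  apply: eq_bigr => i _; rewrite linear_sum mulmx_sumr linear_sum.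
  by apply: eq_bigr => j _; rewrite linearZ -scalemxAr linearZ.
rewrite exchange_big; apply: eq_bigr => i _; rewrite mxE.
by apply: eq_bigr => j _; rewrite mxE mulrC.
Qed.

(** This is 2 Re <X, M> - <X, (L_N + t R_M) X> for the Hilbert-Schmidt product, with L_N left
    multiplication by [N] and R_M right multiplication by [M]. *)
Definition quadJ d (t : R) (M N X : 'M[C]_d) : R :=
  2 * complex.Re (\tr (X^H *m M)) - complex.Re (\tr (N *m (X *m X^H)))
  - t * complex.Re (\tr (M *m (X^H *m X))).

(* The two quadratic terms decrease when X is replaced by Y = Phi^*(X): this is
   the Schwarz inequality for the dual map, read off from the positivity of
   id_2 (x) Phi on the block matrix (V_i N V_j^* ) with V = (1, -Y^* ), resp.
   (V_i M V_j^* ) with V = (1, -Y). *)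
Lemma quadJ_channel d (Phi : {linear 'M[C]_d -> 'M[C]_d}) (t : R) M N X :
  channel Phi -> 0 <= t -> psdmx M -> psdmx N ->
  exists Y, quadJ t (Phi M) (Phi N) X <= quadJ t M N Y.
Proof.
move=> [cpPhi trPhi] t0 hM hN.
have [Z hZ] := trace_dual Phi (X^H); set Y := Z^H.
have YZ : Y^H = Z by rewrite adjmxK.
(* The trace of [cp_schwarz]: trace preservation removes [Phi] from the last term, and the two cross
   terms are conjugate, so their real parts agree. *)
have key V W rho : psdmx rho ->
   0 <= complex.Re (\tr (Phi rho *m (W *m W^H))) +
        complex.Re (\tr (W^H *m Phi (rho *m V^H))) *+ 2 +
        complex.Re (\tr (rho *m (V^H *m V))).
  move=> hr; have := psdmx_trace_ge0 (cp_schwarz V W cpPhi hr).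
  rewrite 3!mxtraceD 3!ReD trPhi.
  have -> : complex.Re (\tr (Phi (V *m rho) *m W)) =
            complex.Re (\tr (W^H *m Phi (rho *m V^H))).
    rewrite -Re_conj -mxtrace_adj adjmxM (cp_adj _ cpPhi) adjmxM.
    by rewrite (psdmx_herm hr).
  rewrite -(mulmxA W^H) (mxtrace_mulC W^H) -(mulmxA _ W).
  rewrite -(mulmxA V) (mxtrace_mulC V) -(mulmxA rho).
  by rewrite mulr2n !addrA.
have keyN := key (- Z) X N hN; have keyM := key (- Y) (X^H) M hM.
have eN : complex.Re (\tr (X^H *m Phi (N *m (- Z)^H))) =
    - complex.Re (\tr (N *m (Y *m Y^H))).
  rewrite hZ YZ adjmxN -/Y mulmxN mulmxN mxtraceN ReN.
  by rewrite (mxtrace_mulC Z) mulmxA.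
have eM : complex.Re (\tr (X^H^H *m Phi (M *m (- Y)^H))) =
    - complex.Re (\tr (M *m (Y^H *m Y))).
  rewrite -Re_conj -mxtrace_adj adjmxM (cp_adj _ cpPhi) (adjmxM M) !adjmxK.
  rewrite (psdmx_herm hM) (mxtrace_mulC (Phi _)) hZ mulNmx mulmxN.
  by rewrite mxtraceN ReN ?YZ mulmxA (mxtrace_mulC _ M).
move: keyN keyM.
rewrite eN eM !adjmxN !mulNmx !mulmxN !opprK adjmxK -/Y ?YZ => keyN keyM.
exists Y; rewrite /quadJ hZ YZ.
exact: quadJ_arith t0 keyN keyM.
Qed.

(** The coordinates [x] refer to [V] on the left and [U] on the right; they diagonalize left
    multiplication by [N] and right multiplication by [M] simultaneously. *)
Lemma trace_conj_coord d (U V : 'M[C]_d) p g M N (x : 'M[C]_d) :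
  eigdec U p M -> eigdec V g N -> let X := V *m x *m U^H in
  [/\ complex.Re (\tr (X^H *m M)) = \sum_j \sum_k
        p j * complex.Re ((x k j)^*%C * (V^H *m U) k j),
      complex.Re (\tr (N *m (X *m X^H))) = \sum_j \sum_k g k * sqn (x k j)
    & complex.Re (\tr (M *m (X^H *m X))) = \sum_j \sum_k p j * sqn (x k j)].
Proof.
move=> eM eN X; have [Uu _] := eM; have [Vu _] := eN.
have XE : V^H *m X *m U = x.
  by rewrite /X -(mulmxA V) (mulmxA V^H) Vu.2 mul1mx -mulmxA Uu.2 mulmx1.
clearbody X.
have XHE : U^H *m X^H *m V = x^H by rewrite -XE !adjmxM adjmxK mulmxA.
split.
- rewrite (mxtrace_mulC X^H). rewrite (trace_eigdec _ eM). rewrite Re_sum. apply: eq_bigr => j _.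
  have -> : U^H *m X^H *m U = x^H *m (V^H *m U).
    by rewrite -XHE -(mulmxA _ V) (mulmxA V) Vu.1 mul1mx.
  rewrite Re_realM mxE Re_sum mulr_sumr.
  by apply: eq_bigr => k _; rewrite adjmxEij.
- rewrite (trace_eigdec _ eN) Re_sum exchange_big; apply: eq_bigr => k _.
  have -> : V^H *m (X *m X^H) *m V = x *m x^H.
    rewrite -XHE -[in RHS]XE -(mulmxA _ U) -(mulmxA U^H) (mulmxA U) Uu.1 mul1mx.
    by rewrite !mulmxA.
  rewrite Re_realM mxE Re_sum mulr_sumr.
  by apply: eq_bigr => j _; rewrite adjmxEij [_ * (_^*)%C]mulrC mul_conj_sqn.
- rewrite (trace_eigdec _ eM) Re_sum; apply: eq_bigr => j _.
  have -> : U^H *m (X^H *m X) *m U = x^H *m x.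
    rewrite -XHE -[in RHS]XE -(mulmxA _ V) -(mulmxA V^H) (mulmxA V) Vu.1 mul1mx.
    by rewrite !mulmxA.
  rewrite Re_realM mxE Re_sum mulr_sumr.
  by apply: eq_bigr => k _; rewrite adjmxEij mul_conj_sqn.
Qed.

(** Completing the square around the maximizer [x = (p / s) c]. *)
Lemma quad_max_le (s p : R) (x c : C) : 0 < s ->
  2 * (p * complex.Re ((x^*)%C * c)) - s * sqn x <= sqn c * (p ^+ 2 / s).
Proof.
case: x c => [a b] [c e] s0; rewrite /sqn /= [leRHS]mulrA ler_pdivlMr //.
rewrite -subr_ge0.
set z := (X in 0 <= X).
have -> : z = (s * a - p * c) ^+ 2 + (s * b - p * e) ^+ 2 by rewrite /z; ring.
by rewrite addr_ge0 ?sqr_ge0.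
Qed.

Lemma quad_max_eq (s p : R) (c : C) : s != 0 ->
  2 * (p * complex.Re ((((p / s)%:C * c)^*)%C * c)) - s * sqn ((p / s)%:C * c)
  = sqn c * (p ^+ 2 / s).
Proof. by case: c => [c e] s0; rewrite /sqn /=; field. Qed.

(** The value of <M, (L_N + t R_M)^-1 M> in eigenbases [U] of [M] and [V] of [N]. *)
Definition resolvent_form d (U V : 'M[C]_d) (p q : 'I_d -> R) (t : R) : R :=
  \sum_j \sum_k overlap V U k j * (p j ^+ 2 / (q k + t * p j)).

Lemma quadJ_coord d (U V : 'M[C]_d) p q M N (x : 'M[C]_d) t :
  eigdec U p M -> eigdec V q N -> quadJ t M N (V *m x *m U^H) =
  \sum_j \sum_k (2 * (p j * complex.Re ((x k j)^*%C * (V^H *m U) k j))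
                 - (q k + t * p j) * sqn (x k j)).
Proof.
move=> eM eN; have [e1 e2 e3] := trace_conj_coord x eM eN.
rewrite /quadJ e1 e2 e3 !mulr_sumr -!sumrB; apply: eq_bigr => j _.
rewrite !mulr_sumr -!sumrB; apply: eq_bigr => k _.
by rewrite [(q k + _) * _]mulrDl opprD addrA -(mulrA t).
Qed.

Lemma quadJ_le_resolvent d (U V : 'M[C]_d) p q M N X t :
  eigdec U p M -> eigdec V q N -> (forall j, 0 <= p j) -> (forall k, 0 < q k) ->
  0 <= t -> quadJ t M N X <= resolvent_form U V p q t.
Proof.
move=> eM eN p0 q0 t0; have [Uu _] := eM; have [Vu _] := eN.
have -> : X = V *m (V^H *m X *m U) *m U^H.
  by rewrite -!mulmxA Uu.1 mulmx1 mulmxA Vu.1 mul1mx.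
rewrite (quadJ_coord _ _ eM eN) ler_sum // => j _; rewrite ler_sum // => k _.
have s0 : 0 < q k + t * p j by rewrite ltr_wpDr ?mulr_ge0.
exact: quad_max_le.
Qed.

Lemma quadJ_eq_resolvent d (U V : 'M[C]_d) p q M N t :
  eigdec U p M -> eigdec V q N -> (forall j, 0 <= p j) -> (forall k, 0 < q k) ->
  0 <= t -> exists X, quadJ t M N X = resolvent_form U V p q t.
Proof.
move=> eM eN p0 q0 t0.
(* The functional decouples into one scalar quadratic per entry; these are the scalar maximizers. *)
pose x := \matrix_(k, j) ((p j / (q k + t * p j))%:C * (V^H *m U) k j).
exists (V *m x *m U^H); rewrite (quadJ_coord _ _ eM eN).
apply: eq_bigr => j _; apply: eq_bigr => k _; rewrite mxE /overlap.
have s0 : q k + t * p j != 0 by rewrite gt_eqF // ltr_wpDr ?mulr_ge0.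
exact: quad_max_eq.
Qed.

(** A maximizer for the image pair, pulled back by the dual map, is a trial matrix for the original
    pair, where the form is an upper bound. *)
Lemma resolvent_form_mono d (Phi : {linear 'M[C]_d -> 'M[C]_d}) (t : R) M N
    (U V U' V' : 'M[C]_d) p q p' q' :
  channel Phi -> 0 <= t ->
  eigdec U p M -> eigdec V q N -> (forall j, 0 <= p j) -> (forall k, 0 < q k) ->
  eigdec U' p' (Phi M) -> eigdec V' q' (Phi N) ->
  (forall j, 0 <= p' j) -> (forall k, 0 < q' k) ->
  resolvent_form U' V' p' q' t <= resolvent_form U V p q t.
Proof.
move=> ch t0 eM eN p0 q0 eM' eN' p0' q0'.
have [X <-] := quadJ_eq_resolvent eM' eN' p0' q0' t0.
have hM := eigdec_psd eM p0; have hN := eigdec_psd eN (fun k => ltW (q0 k)).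
have [Y h] := quadJ_channel X ch t0 hM hN.
exact: le_trans h (quadJ_le_resolvent _ eM eN p0 q0 t0).
Qed.

End Channels.

(** * Logarithms as integrals *)

Section LogIntegral.
Context {R : realType}.

Lemma is_derive_ge0_le (f df : R -> R) (T : R) :
  (forall t : R, 0 <= t -> is_derive t (1 : R) f (df t)) ->
  (forall t : R, 0 <= t -> 0 <= df t) -> 0 <= T -> f 0 <= f T.
Proof.
move=> fd df0 T0.
apply: (@ger0_derive1_ndecr R f 0 T) => //.
- by move=> t; rewrite in_itv /= => /andP[/ltW t0 _]; have [] := fd t t0.
- move=> t; rewrite in_itv /= => /andP[/ltW t0 _]; have [_ E] := fd t t0.
  by rewrite derive1E E df0.
- apply: derivable_within_continuous => t; rewrite in_itv /= => /andP[t0 _].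
  by have [] := fd t t0.
Qed.

Lemma is_derive_ln_affine (c p q t : R) : 0 < q + t * p ->
  is_derive t (1 : R) (fun s => c * ln (q + s * p)) (c * (p / (q + t * p))).
Proof.
move=> h.
have e1 : is_derive t (1 : R) (fun s => q + s * p) p.
  by apply: is_derive_eq; rewrite /GRing.scale /=; ring.
have e2 := @is_derive1_comp R (@ln R) (fun s => q + s * p) t _ _
  (is_derive1_ln h) e1.
have -> : (fun s => c * ln (q + s * p)) = c *: (@ln R \o (fun s => q + s * p)).
  by [].
by apply: is_derive_eq; rewrite /GRing.scale /= [p / _]mulrC.
Qed.

Lemma is_derive_bigsum (I : Type) (r : seq I) (F : I -> R -> R) (dF : I -> R) (t : R) :
  (forall i, is_derive t (1 : R) (F i) (dF i)) ->
  is_derive t (1 : R) (fun s => \sum_(i <- r) F i s) (\sum_(i <- r) dF i).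
Proof.
move=> h; elim: r => [|i r IH].
  under eq_fun do rewrite big_nil; rewrite big_nil; exact: is_derive_cst.
under eq_fun do rewrite big_cons; rewrite big_cons; exact: is_deriveD.
Qed.

(** Together with the next lemma: [p ln (q + T p)] equals [p ln p + p ln T] up to an error between 0
    and [q / T]. *)
Lemma mul_ln_affine_ge (p q T : R) : 0 <= p -> 0 < q -> 0 < T ->
  p * ln p + p * ln T <= p * ln (q + T * p).
Proof.
rewrite le_eqVlt => /predU1P[<-|p0] q0 T0; first by rewrite !mul0r addr0.
rewrite -mulrDr ler_pM2l // -lnM ?posrE // ler_ln ?posrE ?mulr_gt0 //.
  by rewrite mulrC lerDr ltW.
by rewrite ltr_pwDl // mulr_ge0 ?ltW.
Qed.

Lemma mul_ln_affine_le (p q T : R) : 0 <= p -> 0 < q -> 0 < T ->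
  p * ln (q + T * p) <= p * ln p + p * ln T + q / T.
Proof.
rewrite le_eqVlt => /predU1P[<-|p0] q0 T0.
  by rewrite !mul0r !add0r divr_ge0 ?ltW.
have -> : q + T * p = p * T * (1 + q / (T * p)).
  by field; rewrite !gt_eqF.
have h : 0 < q / (T * p) by rewrite divr_gt0 ?mulr_gt0.
rewrite lnM ?posrE ?mulr_gt0 ?addr_gt0 // lnM ?posrE // !mulrDr lerD2l.
have -> : q / T = p * (q / (T * p)) by field; rewrite !gt_eqF.
by rewrite ler_pM2l // le_ln1Dx // (lt_trans _ h).
Qed.

(* p (ln p - ln q) is the integral over t >= 0 of p^2 / (q + t p) - p / (1 + t);
   the subtracted terms cancel between the two families. *)
Lemma sum_log_ratio_le (I J : finType) (w p q : I -> R) (w' p' q' : J -> R) :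
  (forall i, 0 <= w i) -> (forall i, 0 <= p i) -> (forall i, 0 < q i) ->
  (forall j, 0 <= w' j) -> (forall j, 0 <= p' j) -> (forall j, 0 < q' j) ->
  \sum_i w i * p i = \sum_j w' j * p' j ->
  (forall t : R, 0 <= t -> \sum_j w' j * (p' j ^+ 2 / (q' j + t * p' j))
                       <= \sum_i w i * (p i ^+ 2 / (q i + t * p i))) ->
  \sum_j w' j * (p' j * ln (p' j) - p' j * ln (q' j))
  <= \sum_i w i * (p i * ln (p i) - p i * ln (q i)).
Proof.
move=> w0 p0 q0 w0' p0' q0' eS hF.
(* Antiderivatives of the two resolvent sums: comparing increments over [0, T] for large [T]
   replaces the improper integral. *)
pose G (s : R) := \sum_i w i * p i * ln (q i + s * p i).
pose G' (s : R) := \sum_j w' j * p' j * ln (q' j + s * p' j).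
have dG (t : R) : 0 <= t -> is_derive t (1 : R) G
    (\sum_i w i * (p i ^+ 2 / (q i + t * p i))).
  move=> t0; have -> : \sum_i w i * (p i ^+ 2 / (q i + t * p i)) =
      \sum_i w i * p i * (p i / (q i + t * p i)).
    by apply: eq_bigr => i _; rewrite expr2 !mulrA.
  by apply: is_derive_bigsum => i; apply: is_derive_ln_affine;
    rewrite ltr_pwDl // mulr_ge0.
have dG' (t : R) : 0 <= t -> is_derive t (1 : R) G'
    (\sum_j w' j * (p' j ^+ 2 / (q' j + t * p' j))).
  move=> t0; have -> : \sum_j w' j * (p' j ^+ 2 / (q' j + t * p' j)) =
      \sum_j w' j * p' j * (p' j / (q' j + t * p' j)).
    by apply: eq_bigr => i _; rewrite expr2 !mulrA.
  by apply: is_derive_bigsum => i; apply: is_derive_ln_affine;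
    rewrite ltr_pwDl // mulr_ge0.
have mono (T : R) : 0 <= T -> G 0 - G' 0 <= G T - G' T.
  move=> T0; apply: (@is_derive_ge0_le (G - G') (fun t =>
    \sum_i w i * (p i ^+ 2 / (q i + t * p i)) -
    \sum_j w' j * (p' j ^+ 2 / (q' j + t * p' j)))) => //.
    by move=> t t0; apply: is_deriveB; [exact: dG|exact: dG'].
  by move=> t t0; rewrite subr_ge0 hF.
set K := \sum_i w i * q i.
have K0 : 0 <= K by rewrite sumr_ge0 // => i _; rewrite mulr_ge0 // ltW.
(* An arbitrary slack [e] replaces the limit: [T] is chosen so that the error [K / T] is at most
   [e]. *)
apply/ler_addgt0Pr => e e0; pose T := (K + 1) / e.
have T0 : 0 < T by rewrite divr_gt0 // ltr_wpDl.
have KT : K / T <= e.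
  rewrite /T invf_div mulrA mulrAC ler_piMl ?(ltW e0) //.
  by rewrite ler_pdivrMr ?ltr_wpDl // mul1r lerDl.
clearbody T; have h := mono T (ltW T0).
have uT : G T <= \sum_i w i * (p i * ln (p i)) + (\sum_i w i * p i) * ln T + K / T.
  rewrite /G /K !mulr_suml -!big_split /=; apply: ler_sum => i _.
  by rewrite -!mulrA -!(mulrDr (w i)) ler_wpM2l // mul_ln_affine_le.
have lT : \sum_j w' j * (p' j * ln (p' j)) + (\sum_j w' j * p' j) * ln T <= G' T.
  rewrite /G' !mulr_suml -!big_split /=; apply: ler_sum => i _.
  by rewrite -!mulrA -!(mulrDr (w' i)) ler_wpM2l // mul_ln_affine_ge.
have G0 : G 0 = \sum_i w i * (p i * ln (q i)).
  by apply: eq_bigr => i _; rewrite mul0r addr0 mulrA.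
have G0' : G' 0 = \sum_j w' j * (p' j * ln (q' j)).
  by apply: eq_bigr => i _; rewrite mul0r addr0 mulrA.
have split1 (X : finType) (a b c : X -> R) :
    \sum_x a x * (b x - c x) = \sum_x a x * b x - \sum_x a x * c x.
  by rewrite -sumrB; apply: eq_bigr => x _; rewrite mulrBr.
(* Equal total weights make the two [ln T] terms cancel. *)
rewrite !split1 -G0 -G0'; move: uT lT h KT; rewrite eS.
by clear; lra.
Qed.

End LogIntegral.

(** * Relative entropy, entropy and norms *)

Lemma entropy_continuity_arith (R : realDomainType) (Sa Sb x y l T : R) :
  Sa <= - (x + y) -> - x <= Sb - l -> - y <= T -> Sa - Sb <= - l + T.
Proof. by lra. Qed.

Section Entropy.
Context {R : realType}.
Local Notation C := R[i].

(** Positive definiteness in spectral form; as second argument of [relent] such a matrix never meets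
    the convention [ln 0 = 0]. *)
Definition posmx d (N : 'M[C]_d) : Prop :=
  exists V q, eigdec V q N /\ forall k, 0 < q k.

Definition relent d (M N : 'M[C]_d) : R :=
  complex.Re (\tr (M *m mxfun (@ln R) M)) -
  complex.Re (\tr (M *m mxfun (@ln R) N)).

Lemma relent_coord d (U V : 'M[C]_d) p q M N : eigdec U p M -> eigdec V q N ->
  relent M N = \sum_(x : 'I_d * 'I_d)
    overlap V U x.2 x.1 * (p x.1 * ln (p x.1) - p x.1 * ln (q x.2)).
Proof.
move=> eM eN; rewrite /relent.
have E1 := Re_trace_self eM (eigdec_mxfun (@ln R) eM).
have E2 := Re_trace_overlap eM (eigdec_mxfun (@ln R) eN).
apply: (etrans (f_equal2 (fun a b => a - b) E1 E2)); rewrite -sumrB.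
rewrite -(pair_bigA _ (fun j k => overlap V U k j *
  (p j * ln (p j) - p j * ln (q k)))) /=; apply: eq_bigr => j _.
rewrite -[X in X - _]mulr1 -(overlap_suml j eN.1 eM.1) mulr_sumr -sumrB.
by apply: eq_bigr => k _; rewrite mulrBr [X in X - _]mulrC [X in _ - X]mulrC.
Qed.

Lemma sum_overlapl d (U V : 'M[C]_d) (p : 'I_d -> R) : unitary U -> unitary V ->
  \sum_(x : 'I_d * 'I_d) overlap V U x.2 x.1 * p x.1 = \sum_j p j.
Proof.
move=> Uu Vu.
rewrite -(pair_bigA _ (fun j k => overlap V U k j * p j)) /=.
by apply: eq_bigr => j _; rewrite -mulr_suml overlap_suml // mul1r.
Qed.

Lemma sum_overlapr d (U V : 'M[C]_d) (q : 'I_d -> R) : unitary U -> unitary V ->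
  \sum_(x : 'I_d * 'I_d) overlap V U x.2 x.1 * q x.2 = \sum_k q k.
Proof.
move=> Uu Vu.
rewrite -(pair_bigA _ (fun j k => overlap V U k j * q k)) /= exchange_big.
by apply: eq_bigr => j _; rewrite -mulr_suml overlap_sumr // mul1r.
Qed.

(** Data processing: the overlaps are the weights in [sum_log_ratio_le], trace preservation equates
    the total masses, and [resolvent_form_mono] compares the integrands. *)
Lemma relent_channel d (Phi : {linear 'M[C]_d -> 'M[C]_d}) M N :
  channel Phi -> psdmx M -> posmx N -> posmx (Phi N) ->
  relent (Phi M) (Phi N) <= relent M N.
Proof.
move=> ch hM [V [q [eN q0]]] [V' [q' [eN' q0']]].
have [U [p [eM p0]]] := psdmx_eigdec hM.
have [U' [p' [eM' p0']]] := psdmx_eigdec (cp_psd ch.1 hM).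
rewrite (relent_coord eM eN) (relent_coord eM' eN').
apply: (@sum_log_ratio_le R _ _
  (fun x => overlap V U x.2 x.1) (fun x => p x.1) (fun x => q x.2)
  (fun x => overlap V' U' x.2 x.1) (fun x => p' x.1) (fun x => q' x.2)) => //.
- by move=> x; exact: overlap_ge0.
- by move=> x; exact: overlap_ge0.
- rewrite (sum_overlapl _ eM.1 eN.1) (sum_overlapl _ eM'.1 eN'.1).
  by apply: complexI; rewrite -(trace_eigdecE eM) -(trace_eigdecE eM') ch.2.
- move=> t t0; have := resolvent_form_mono ch t0 eM eN p0 q0 eM' eN' p0' q0'.
  by rewrite /resolvent_form !pair_bigA.
Qed.

(** For positive [p] this is [ln x <= x - 1] at [x = q / p]. *)
Lemma ln_klein (p q : R) : 0 <= p -> 0 < q -> p - q <= p * ln p - p * ln q.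
Proof.
rewrite le_eqVlt => /predU1P[<-|p0] q0.
  by rewrite !mul0r sub0r subrr oppr_le0 ltW.
have := @le_ln1Dx R (q / p - 1) _; rewrite ltrBrDl subrr divr_gt0 // => /(_ isT).
rewrite addrC subrK ln_div ?posrE // => h.
have : p * (ln q - ln p) <= p * (q / p - 1) by rewrite ler_pM2l.
have -> : p * (q / p - 1) = q - p by field; rewrite gt_eqF.
by clear; lra.
Qed.

(** The scalar inequality is averaged with the overlaps as weights; its lower bound sums to the
    difference of the traces, which is 0. *)
Lemma klein_ineq d (M N : 'M[C]_d) : psdmx M -> posmx N -> \tr M = \tr N ->
  0 <= relent M N.
Proof.
move=> /psdmx_eigdec[U [p [eM p0]]] [V [q [eN q0]]] tr.
rewrite (relent_coord eM eN).
rewrite [leLHS](_ : 0 =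
    \sum_(x : 'I_d * 'I_d) overlap V U x.2 x.1 * (p x.1 - q x.2)).
  by apply: ler_sum => x _; rewrite ler_wpM2l ?overlap_ge0 ?ln_klein.
under eq_bigr do rewrite mulrBr.
rewrite sumrB (sum_overlapl _ eM.1 eN.1) (sum_overlapr _ eM.1 eN.1).
move: tr; rewrite (trace_eigdecE eM) (trace_eigdecE eN) => /complexI ->.
by rewrite subrr.
Qed.

Lemma entropy_le_cross d (M N : 'M[C]_d) : psdmx M -> posmx N ->
  \tr M = \tr N -> entropy M <= - complex.Re (\tr (M *m mxfun (@ln R) N)).
Proof.
move=> hM hN tr; have := klein_ineq hM hN tr.
by rewrite /relent subr_ge0 /entropy lerN2.
Qed.

(** * Entropy bounds for states *)

Lemma state_eigdec d (M : 'M[C]_d) : state M ->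
  exists U p, [/\ eigdec U p M, forall j, 0 <= p j, forall j, p j <= 1
                & \sum_j p j = 1].
Proof.
move=> [/psdmx_eigdec[U [p [eM p0]]] tr].
have s1 : \sum_j p j = 1 by apply: complexI; rewrite -(trace_eigdecE eM).
exists U, p; split=> // j.
by rewrite -s1 (bigD1 j) //= lerDl sumr_ge0.
Qed.

Lemma entropy_state_ge0 d (M : 'M[C]_d) : state M -> 0 <= entropy M.
Proof.
move=> /state_eigdec[U [p [eM p0 p1 _]]].
rewrite (entropy_eigdec eM) oppr_ge0 sumr_le0 // => j _.
by rewrite mulr_ge0_le0 // ln_le0.
Qed.

Lemma eigdec_affine d (U : 'M[C]_d) p M (a b : R) : eigdec U p M ->
  eigdec U (fun j => a * p j + b) (a%:C *: M + (b%:C)%:M).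
Proof.
move=> [Uu ->]; split=> //.
have -> : rdiag (fun j => a * p j + b) = a%:C *: rdiag p + (b%:C)%:M.
  apply/matrixP=> i j; rewrite rdiagE !mxE rmorphD rmorphM.
  by case: (i == j); rewrite ?mulr1n ?mulr0n ?mulr0 ?addr0.
rewrite mulmxDr mulmxDl -scalemxAr -scalemxAl scalar_mxC -(mulmxA _ U) Uu.1.
by rewrite mulmx1.
Qed.

Lemma trace_affine d (M : 'M[C]_d) (a b : R) :
  \tr (a%:C *: M + (b%:C)%:M) = a%:C * \tr M + (b *+ d)%:C.
Proof.
rewrite mxtraceD mxtraceZ; congr (_ + _).
by rewrite mxtrace_scalar rmorphMn.
Qed.

Lemma eigdec1 d (a : R) : eigdec (1%:M : 'M[C]_d) (fun=> a) (a%:C)%:M.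
Proof.
split; first exact: unitary1.
rewrite adjmx1 mul1mx mulmx1; apply/matrixP=> i j.
by rewrite rdiagE mxE.
Qed.

(** The cross entropy relative to the maximally mixed state is [ln d] for every state. *)
Lemma entropy_state_le d (M : 'M[C]_d) : (0 < d)%N -> state M ->
  entropy M <= ln d%:R.
Proof.
move=> d0 hM; have d0' : 0 < d%:R :> R by rewrite ltr0n.
have e1 : eigdec 1%:M (fun=> d%:R^-1) ((d%:R^-1 : R)%:C%:M : 'M[C]_d).
  exact: eigdec1.
have pos : posmx ((d%:R^-1 : R)%:C%:M : 'M[C]_d).
  by exists 1%:M, (fun=> d%:R^-1); split=> // k; rewrite invr_gt0.
have tr : \tr M = \tr ((d%:R^-1 : R)%:C%:M : 'M[C]_d).
  rewrite hM.2 mxtrace_scalar -rmorphMn -mulr_natr mulVf ?rmorph1 //.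
  by rewrite gt_eqF.
apply: le_trans (entropy_le_cross hM.1 pos tr) _.
have [U [p [eM p0 _ s1]]] := state_eigdec hM.
rewrite (Re_trace_overlap eM (eigdec_mxfun (@ln R) e1)).
have -> : \sum_j \sum_k p j * (@ln R \o (fun=> d%:R^-1)) k * overlap 1%:M U k j =
    \sum_j p j * ln d%:R^-1.
  apply: eq_bigr => j _ /=; rewrite -mulr_sumr overlap_suml ?mulr1 //.
    exact: unitary1.
  exact: eM.1.
by rewrite -mulr_suml s1 mul1r lnV ?posrE // opprK.
Qed.

(* Compare both entropies with the cross entropy relative to
   (1 - s) b + s / d, which commutes with b and is bounded below by s / d. *)
Lemma entropy_continuity d (a b : 'M[C]_d) (s : R) : (0 < d)%N ->
  state a -> state b -> 0 < s -> s < 1 ->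
  entropy a - entropy b <= - ln (1 - s) + trnorm (a - b) / 2 * ln (d%:R / s).
Proof.
move=> d0 ha hb s0 s1; have d0' : 0 < d%:R :> R by rewrite ltr0n.
have [W [r [eb r0 r1 sr]]] := state_eigdec hb.
set N := (1 - s)%:C *: b + ((s / d%:R)%:C)%:M.
have eN : eigdec W (fun k => (1 - s) * r k + s / d%:R) N by exact: eigdec_affine.
set q := (fun k => _) in eN.
have sd0 : 0 < s / d%:R by rewrite divr_gt0.
have s1' : 0 < 1 - s by rewrite subr_gt0.
have qge k : s / d%:R <= q k by rewrite lerDr mulr_ge0 // ltW.
have q0 k : 0 < q k by exact: lt_le_trans sd0 (qge k).
have q1 k : q k <= 1.
  have : s / d%:R <= s by rewrite ler_pdivrMr // ler_peMr ?ler1n // ltW.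
  have : (1 - s) * r k <= 1 - s by rewrite ler_piMr // ltW.
  by rewrite /q; clear; lra.
have pN : posmx N by exists W, q.
have trN : \tr a = \tr N.
  have E : (s / d%:R) *+ d = s by rewrite -[_ *+ d]mulr_natr divfK ?gt_eqF.
  by rewrite /N trace_affine ha.2 hb.2 mulr1 E -rmorphD subrK.
have Hcross := entropy_le_cross ha.1 pN trN.
have eL := eigdec_mxfun (@ln R) eN.
set K := mxfun _ N in Hcross eL.
have split_tr : complex.Re (\tr (a *m K)) =
    complex.Re (\tr (b *m K)) + complex.Re (\tr ((a - b) *m K)).
  by rewrite -ReD -mxtraceD -mulmxDl addrC subrK.
(* Each [q k] is at least [(1 - s) * r k], so passing from [b] to [N] costs at most [- ln (1 - s)];
   zero eigenvalues of [b] contribute nothing. *)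
have hbK : - complex.Re (\tr (b *m K)) <= entropy b - ln (1 - s).
  rewrite (Re_trace_self eb eL) (entropy_eigdec eb) -opprD lerN2.
  rewrite [X in _ + X](_ : _ = \sum_k r k * ln (1 - s)); last first.
    by rewrite -mulr_suml sr mul1r.
  rewrite -big_split /=; apply: ler_sum => k _; rewrite -mulrDr.
  have := r0 k; rewrite le_eqVlt => /predU1P[<-|rk0]; first by rewrite !mul0r.
  rewrite ler_pM2l //= -lnM ?posrE // ler_ln ?posrE ?mulr_gt0 //.
  by rewrite /q mulrC lerDl ltW.
set L := ln (d%:R / s).
have habK : - complex.Re (\tr ((a - b) *m K)) <= trnorm (a - b) / 2 * L.
  have hab : (a - b)^H = a - b.
    by rewrite adjmxD adjmxN (psdmx_herm ha.1) (psdmx_herm hb.1).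
  have [U [l eab]] := herm_eigdec hab.
  have sl : \sum_j l j = 0.
    apply: complexI; rewrite -(trace_eigdecE eab).
    by rewrite mxtraceD mxtraceN ha.2 hb.2 subrr.
  rewrite (trnorm_eigdec eab) (Re_trace_overlap eab eL).
  (* The eigenvalues of [a - b] sum to 0, so [L / 2] may be subtracted from weights lying in [0, L];
     this centring produces the factor 1/2. *)
  have shift : - \sum_j \sum_k l j * (@ln R \o q) k * overlap W U k j =
      \sum_j l j * (- L / 2 + \sum_k (- ln (q k)) * overlap W U k j).
    rewrite -sumrN; under [RHS]eq_bigr do rewrite mulrDr.
    rewrite big_split /= -mulr_suml sl mul0r add0r.
    apply: eq_bigr => j _; rewrite -sumrN mulr_sumr; apply: eq_bigr => k _.
    by rewrite mulNr mulrN mulrA.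
  rewrite shift -mulrA mulr_suml; apply: ler_sum => j _.
  set kap := \sum_k _.
  have kap0 : 0 <= kap.
    by rewrite sumr_ge0 // => k _; rewrite mulr_ge0 ?overlap_ge0 // oppr_ge0 ln_le0.
  have kapL : kap <= L.
    rewrite -[L]mulr1 -(overlap_suml j eb.1 eab.1) mulr_sumr.
    apply: ler_sum => k _; rewrite ler_wpM2r ?overlap_ge0 //.
    rewrite /L -[d%:R / s]invf_div lnV ?posrE // lerN2 ler_ln ?posrE //.
  apply: le_trans (ler_norm _) _; rewrite normrM ler_wpM2l //.
  by rewrite ler_norml; apply/andP; split; move: kap0 kapL; clear; lra.
move: Hcross hbK habK; rewrite split_tr; exact: entropy_continuity_arith.
Qed.

(** * Operator norm and Hoelder's inequality *)

Definition sqnormv d (v : 'cV[C]_d) : R := \sum_i sqn (v i 0).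

Lemma vnormE d (v : 'cV[C]_d) : vnorm v = Num.sqrt (sqnormv v).
Proof.
rewrite /vnorm -adjmxE mxE Re_sum; congr Num.sqrt; apply: eq_bigr => i _.
by rewrite adjmxEij mul_conj_sqn.
Qed.

Lemma sqnormv_unitary d (U : 'M[C]_d) (v : 'cV[C]_d) : unitary U ->
  sqnormv (U *m v) = sqnormv v.
Proof.
have E (w : 'cV[C]_d) : (sqnormv w)%:C = (w^H *m w) 0 0.
  rewrite mxE /sqnormv rmorph_sum; apply: eq_bigr => i _.
  by rewrite adjmxEij mul_conj_sqn.
move=> Uu; apply: complexI; rewrite !E adjmxM mulmxA -(mulmxA _ U^H) Uu.2.
by rewrite mulmx1.
Qed.

Lemma sqnormv_eigdec d (U : 'M[C]_d) h H (v : 'cV[C]_d) : eigdec U h H ->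
  sqnormv (H *m v) = \sum_i h i ^+ 2 * sqn ((U^H *m v) i 0).
Proof.
move=> [Uu ->]; rewrite -!mulmxA sqnormv_unitary //.
apply: eq_bigr => i _; rewrite mul_rdiagl.
by case: ((_ *m v) i 0) => x y; rewrite /sqn /=; ring.
Qed.

Lemma opnorm_eigdec_ge d (U : 'M[C]_d) h H k : eigdec U h H ->
  `|h k| <= opnorm H.
Proof.
move=> eH; have Uu := eH.1; rewrite /opnorm; apply: sup_upper_bound; last first.
  (* The k-th eigenvector is a unit vector on which the value [|h k|] is attained. *)
  exists (U *m delta_mx k 0) => /=.
    rewrite vnormE sqnormv_unitary // /sqnormv (bigD1 k) //= big1 => [|i ik].
      by rewrite mxE !eqxx /sqn /= expr1n expr0n !addr0 sqrtr1.
    by rewrite mxE (negPf ik) /sqn /= expr0n addr0.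
  rewrite vnormE (sqnormv_eigdec _ eH) (bigD1 k) //= big1 => [|i ik].
    rewrite mulmxA Uu.2 mul1mx mxE !eqxx /sqn /= expr1n expr0n !addr0 mulr1.
    by rewrite sqrtr_sqr.
  by rewrite mulmxA Uu.2 mul1mx mxE (negPf ik) /sqn /= expr0n addr0 mulr0.
(* The supremum is an upper bound only once the set is nonempty and bounded; the crude bound by the
   sum of all [|h i|] suffices. *)
split.
  by exists (vnorm (H *m 0)); exists 0; rewrite //= vnormE /sqnormv big1
    ?sqrtr0 // => i _; rewrite mxE /sqn /= expr0n addr0.
exists (\sum_i `|h i|) => _ /= [v v1 <-].
rewrite vnormE; apply: (@le_trans _ _ (Num.sqrt ((\sum_i `|h i|) ^+ 2))); last first.
  by rewrite sqrtr_sqr ger0_norm ?sumr_ge0.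
rewrite ler_wsqrtr // (sqnormv_eigdec _ eH).
have v1' : sqnormv v <= 1.
  by move: v1; rewrite vnormE -{1}sqrtr1 ler_sqrt.
rewrite -[leRHS]mulr1; apply: (@le_trans _ _ ((\sum_i `|h i|) ^+ 2 * sqnormv (U^H *m v))).
  rewrite mulr_sumr ler_sum // => i _; rewrite ler_wpM2r ?sqn_ge0 //.
  rewrite -[h i ^+ 2]real_normK ?num_real //.
  rewrite ler_sqr ?nnegrE ?sumr_ge0 //.
  by rewrite (bigD1 i) //= lerDl sumr_ge0.
rewrite ler_wpM2l ?sqr_ge0 // sqnormv_unitary //; exact: unitary_adj.
Qed.

Lemma opnorm_ge0 d (M : 'M[C]_d) : 0 <= opnorm M.
Proof.
rewrite /opnorm; set S := [set _ | _ in _]%classic.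
(* If the set had no supremum, [sup] would take its default value 0. *)
have [hS|hS] := pselect (has_sup S); last by rewrite sup_out.
apply: (@le_trans _ _ (vnorm (M *m 0))); first by rewrite sqrtr_ge0.
apply: sup_upper_bound => //; exists 0 => //=.
by rewrite vnormE /sqnormv big1 ?sqrtr0 // => i _; rewrite mxE /sqn /= expr0n addr0.
Qed.

(** In eigenbases the trace is a sum of [l j * h k] weighted by overlaps; each [|h k|] is at most
    [opnorm H] and the weights sum to 1 over [k]. *)
Lemma abs_trace_le d (H X : 'M[C]_d) : H^H = H -> X^H = X ->
  `|complex.Re (\tr (X *m H))| <= opnorm H * trnorm X.
Proof.
move=> /herm_eigdec[V [h eH]] /herm_eigdec[U [l eX]].
rewrite (Re_trace_overlap eX eH) (trnorm_eigdec eX) mulr_sumr.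
apply: le_trans (ler_norm_sum _ _ _) _; apply: ler_sum => j _.
apply: le_trans (ler_norm_sum _ _ _) _.
rewrite -[leRHS]mulr1 -(overlap_suml j eH.1 eX.1) mulr_sumr.
apply: ler_sum => k _; rewrite !normrM [`|l j| * _]mulrC.
rewrite (ger0_norm (overlap_ge0 _ _ _ _)) ler_wpM2r ?overlap_ge0 //.
by rewrite ler_wpM2r // (opnorm_eigdec_ge _ eH).
Qed.

Lemma trnorm_state d (M : 'M[C]_d) : state M -> trnorm M = 1.
Proof.
move=> /state_eigdec[U [p [eM p0 _ s1]]]; rewrite (trnorm_eigdec eM) -s1.
by apply: eq_bigr => j _; rewrite ger0_norm.
Qed.

End Entropy.

(** * Subsystems *)

Section Subsystems.
Context {R : realType} {n : nat}.
Local Notation C := R[i].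
Local Notation restrict := Defs.restrict.
Implicit Types (A B : {set 'I_n}).

Lemma restrict_eqP A (x y : 'I_#|{ffun 'I_n -> bool}|) :
  restrict A x = restrict A y <-> {in A, forall i, enum_val x i = enum_val y i}.
Proof.
split=> [/enum_rank_inj /ffunP h i iA|h].
  by have := h (exist _ i iA); rewrite !ffunE.
by congr enum_rank; apply/ffunP => j; rewrite !ffunE h ?(valP j).
Qed.

Lemma basis_eqP (x y : 'I_#|{ffun 'I_n -> bool}|) :
  (forall i, enum_val x i = enum_val y i) -> x = y.
Proof. by move=> h; apply: enum_val_inj; apply/ffunP. Qed.

(** Inverse to the pair of restrictions; the last branch is never reached, since [A] and its
    complement cover all labels. *)
Definition glue A (a : 'I_#|{ffun qubits A -> bool}|)
    (b : 'I_#|{ffun qubits (~: A) -> bool}|) : 'I_#|{ffun 'I_n -> bool}| :=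
  enum_rank [ffun i => if insub i : option (qubits A) is Some u
    then enum_val a u
    else if insub i : option (qubits (~: A)) is Some v then enum_val b v
    else false].

Arguments glue : clear implicits.

Lemma restrict_glue A a b : restrict A (glue A a b) = a.
Proof.
apply: enum_val_inj; apply/ffunP => j.
by rewrite /restrict /glue !enum_rankK !ffunE valK.
Qed.

Lemma restrict_glueC A a b : restrict (~: A) (glue A a b) = b.
Proof.
apply: enum_val_inj; apply/ffunP => j.
rewrite /restrict /glue !enum_rankK !ffunE insubN ?valK //.
by have := valP j; rewrite inE.
Qed.

Lemma glue_restrict A x : glue A (restrict A x) (restrict (~: A) x) = x.
Proof.
apply: basis_eqP => i; case iA: (i \in A).
  by move: i iA; apply/restrict_eqP; rewrite restrict_glue.
have {iA} : i \in ~: A by rewrite inE iA.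
by move: i; apply/restrict_eqP; rewrite restrict_glueC.
Qed.

Lemma sum_glue (V : nmodType) A (F : 'I_#|{ffun 'I_n -> bool}| -> V) :
  \sum_x F x = \sum_a \sum_b F (glue A a b).
Proof.
rewrite pair_bigA /= (reindex (fun p => glue A p.1 p.2)) //.
exists (fun x => (restrict A x, restrict (~: A) x)) => [[a b]|x] _ /=.
  by rewrite restrict_glue restrict_glueC.
exact: glue_restrict.
Qed.

Lemma tensor_glue A X Y a b a' b' :
  tensor X Y (glue A a b) (glue A a' b') = X a a' * Y b b' :> C.
Proof. by rewrite mxE !restrict_glue !restrict_glueC. Qed.

Lemma tensor_eqP A (M N : op R 'I_n) :
  (forall a b a' b', M (glue A a b) (glue A a' b') = N (glue A a b) (glue A a' b')) ->
  M = N.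
Proof.
move=> h; apply/matrixP => x y.
by rewrite -(glue_restrict A x) -(glue_restrict A y) h.
Qed.

(** * Tensor products *)

Lemma tensorM A (X X' : op R (qubits A)) (Y Y' : op R (qubits (~: A))) :
  tensor X Y *m tensor X' Y' = tensor (X *m X') (Y *m Y').
Proof.
apply: (@tensor_eqP A) => a b a' b'; rewrite tensor_glue !mxE (sum_glue A).
rewrite big_distrlr /=; apply: eq_bigr => c _; apply: eq_bigr => e _.
by rewrite !tensor_glue mulrACA.
Qed.

Lemma tensor_adj A (X : op R (qubits A)) (Y : op R (qubits (~: A))) :
  (tensor X Y)^H = tensor X^H Y^H.
Proof.
apply: (@tensor_eqP A) => a b a' b'.
by rewrite adjmxEij !tensor_glue !adjmxEij rmorphM.
Qed.

Lemma glue_eq A a b a' b' :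
  (glue A a b == glue A a' b') = (a == a') && (b == b').
Proof.
apply/eqP/andP => [E|[/eqP-> /eqP->] //].
split; apply/eqP; first by rewrite -(restrict_glue a b) E restrict_glue.
by rewrite -(restrict_glueC a b) E restrict_glueC.
Qed.

Lemma tensor_rdiag A (p : 'I_#|{ffun qubits A -> bool}| -> R)
    (q : 'I_#|{ffun qubits (~: A) -> bool}| -> R) :
  tensor (rdiag p) (rdiag q) =
  rdiag (fun x => p (restrict A x) * q (restrict (~: A) x)).
Proof.
apply: (@tensor_eqP A) => a b a' b'.
rewrite tensor_glue !rdiagE glue_eq restrict_glue restrict_glueC rmorphM.
by case: (a == a'); case: (b == b'); rewrite ?mulr1n ?mulr0n ?mulr0 ?mul0r.
Qed.

Lemma tensor1 A : tensor (1%:M : op R (qubits A)) 1%:M = 1%:M.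
Proof.
apply: (@tensor_eqP A) => a b a' b'; rewrite tensor_glue !mxE glue_eq.
by case: (a == a'); case: (b == b'); rewrite ?mulr1n ?mulr0n ?mulr0 ?mul0r ?mulr1.
Qed.

Lemma tensor_unitary A (U : op R (qubits A)) (W : op R (qubits (~: A))) :
  unitary U -> unitary W -> unitary (tensor U W).
Proof.
by move=> [u1 u2] [w1 w2]; split; rewrite tensor_adj tensorM ?u1 ?w1 ?u2 ?w2
  tensor1.
Qed.

Lemma tensor_eigdec A U p W q (X : op R (qubits A)) Y :
  eigdec U p X -> eigdec W q Y ->
  eigdec (tensor U W) (fun x => p (restrict A x) * q (restrict (~: A) x))
    (tensor X Y).
Proof.
move=> [Uu ->] [Wu ->]; split; first exact: tensor_unitary.
by rewrite -!tensorM tensor_rdiag tensor_adj.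
Qed.

Lemma mxtrace_tensor A (X : op R (qubits A)) (Y : op R (qubits (~: A))) :
  \tr (tensor X Y) = \tr X * \tr Y.
Proof.
rewrite /mxtrace (sum_glue A) big_distrlr /=.
by apply: eq_bigr => a _; apply: eq_bigr => b _; rewrite tensor_glue.
Qed.

Lemma tensor_state A (X : op R (qubits A)) (Y : op R (qubits (~: A))) :
  state X -> state Y -> state (tensor X Y).
Proof.
move=> hX hY; split; last by rewrite mxtrace_tensor hX.2 hY.2 mulr1.
have [U [p [eX p0 _ _]]] := state_eigdec hX.
have [W [q [eY q0 _ _]]] := state_eigdec hY.
by apply: eigdec_psd (tensor_eigdec eX eY) _ => x; rewrite mulr_ge0.
Qed.

Lemma mul_lnM (p q : R) : 0 <= p -> 0 <= q ->
  p * q * ln (p * q) = p * ln p * q + p * (q * ln q).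
Proof.
rewrite !le_eqVlt => /predU1P[<-|p0]; first by rewrite !mul0r addr0.
move=> /predU1P[<-|q0]; first by rewrite !(mul0r, mulr0) addr0.
by rewrite lnM ?posrE //; ring.
Qed.

(** The eigenvalues are the products [p a * q b]; the logarithm splits and each spectrum sums to
    1. *)
Lemma entropy_tensor A (X : op R (qubits A)) (Y : op R (qubits (~: A))) :
  state X -> state Y -> entropy (tensor X Y) = entropy X + entropy Y.
Proof.
move=> hX hY.
have [U [p [eX p0 _ p1]]] := state_eigdec hX.
have [W [q [eY q0 _ q1]]] := state_eigdec hY.
rewrite (entropy_eigdec (tensor_eigdec eX eY)) (entropy_eigdec eX).
rewrite (entropy_eigdec eY) -opprD; congr (- _); rewrite (sum_glue A).
rewrite [X in _ = X + _](_ : _ = \sum_a \sum_b p a * ln (p a) * q b); last first.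
  by rewrite -[LHS]mulr1 -q1 big_distrlr.
rewrite [X in _ = _ + X](_ : _ = \sum_a \sum_b p a * (q b * ln (q b))); last first.
  by rewrite -[LHS]mul1r -p1 big_distrlr.
rewrite -big_split /=.
apply: eq_bigr => a _; rewrite -big_split /=; apply: eq_bigr => b _.
by rewrite restrict_glue restrict_glueC mul_lnM.
Qed.

(** * Marginals and operators supported on a subsystem *)

Lemma marginal_sum A (M : op R 'I_n) a b :
  marginal A M a b = \sum_z M (glue A a z) (glue A b z).
Proof.
rewrite mxE (sum_glue A) (bigD1 a) //= [X in _ + X]big1 ?addr0; last first.
  move=> a' /negPf a'a; rewrite big1 // => z _; rewrite big1 // => y.
  by rewrite restrict_glue a'a.
apply: eq_bigr => z _; rewrite (big_pred1 (glue A b z)) // => y /=.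
by rewrite -[in RHS](glue_restrict A y) glue_eq restrict_glue restrict_glueC
  eqxx /= [z == _]eq_sym.
Qed.

(** Selecting rows and columns is a congruence by a 0/1 matrix. *)
Lemma psdmx_mxsub m d (f : 'I_m -> 'I_d) (M : 'M[C]_d) :
  psdmx M -> psdmx (mxsub f f M).
Proof.
move=> hM; have -> : mxsub f f M = rowsub f 1%:M *m M *m (rowsub f 1%:M)^H.
  rewrite -rowsubE; apply/matrixP => i j; rewrite !mxE (bigD1 (f j)) //= big1.
    by rewrite !mxE adjmxEij !mxE eqxx rmorph1 mulr1 addr0.
  by move=> k kj; rewrite !mxE adjmxEij !mxE eq_sym (negPf kj) rmorph0 mulr0.
exact: psdmx_congr.
Qed.

Lemma marginal_state A (M : op R 'I_n) : state M -> state (marginal A M).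
Proof.
move=> [hM tM]; split; last first.
  rewrite -tM /mxtrace (sum_glue A); apply: eq_bigr => a _.
  by rewrite marginal_sum.
(* The partial trace is a sum of principal submatrices, one for each configuration [z] outside
   [A]. *)
have -> : marginal A M = \sum_z mxsub (glue A ^~ z) (glue A ^~ z) M.
  apply/matrixP => a b; rewrite marginal_sum summxE.
  by apply: eq_bigr => z _; rewrite mxE.
by apply: psdmx_sum => z; exact: psdmx_mxsub.
Qed.

Lemma trace_tensor_marginal A (X : op R (qubits A)) (M : op R 'I_n) :
  \tr (tensor X 1%:M *m M) = \tr (X *m marginal A M).
Proof.
rewrite /mxtrace (sum_glue A); apply: eq_bigr => a _; rewrite mxE.
under [RHS]eq_bigr do rewrite marginal_sum mulr_sumr.
rewrite exchange_big /=; apply: eq_bigr => z _; rewrite mxE (sum_glue A).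
apply: eq_bigr => b _; rewrite (bigD1 z) //= big1 ?addr0 => [|z' z'z].
  by rewrite tensor_glue mxE eqxx mulr1.
by rewrite tensor_glue mxE eq_sym (negPf z'z) mulr0 mul0r.
Qed.

Lemma marginal_tensorl A (X : op R (qubits A)) (Y : op R (qubits (~: A))) :
  \tr Y = 1 -> marginal A (tensor X Y) = X.
Proof.
move=> tY; apply/matrixP => a b; rewrite marginal_sum.
under eq_bigr do rewrite tensor_glue.
by rewrite -mulr_sumr -/(mxtrace Y) tY mulr1.
Qed.

(** The marginal on [~: A] compares restrictions to [~: ~: A], whose index type differs from that of
    [A]; only the comparison is transferred. *)
Lemma restrict_setCC A x y :
  (restrict (~: ~: A) x == restrict (~: ~: A) y) = (restrict A x == restrict A y).
Proof.
apply/eqP/eqP => /restrict_eqP h; apply/restrict_eqP => i iA; apply: h.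
  by rewrite finset.setCK.
by rewrite finset.setCK in iA.
Qed.

Lemma marginal_tensorr A (X : op R (qubits A)) (Y : op R (qubits (~: A))) :
  \tr X = 1 -> marginal (~: A) (tensor X Y) = Y.
Proof.
move=> tX; apply/matrixP => a b; rewrite mxE (sum_glue A).
rewrite -[RHS]mul1r -tX mulr_suml; apply: eq_bigr => c _.
rewrite (bigD1 a) //= [X in _ + X]big1 ?addr0; last first.
  move=> a' /negPf a'a; rewrite big1 // => y.
  by rewrite restrict_glueC a'a.
rewrite (big_pred1 (glue A c b)) ?tensor_glue // => y /=.
by rewrite restrict_setCC -[in RHS](glue_restrict A y) glue_eq restrict_glue
  restrict_glueC eqxx /= andbC [c == _]eq_sym.
Qed.

Lemma acts_on_subset A B (H : op R 'I_n) :
  B \subset A -> acts_on B H -> acts_on A H.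
Proof.
move=> /fintype.subsetP BA [X ->].
(* A fixed filling outside [A]: the operator on [A] is read off from the entries of [tensor X 1%:M]
   at configurations filled this way. *)
pose z0 := enum_rank [ffun=> false] : 'I_#|{ffun qubits (~: A) -> bool}|.
exists (\matrix_(a, b) tensor X 1%:M (glue A a z0) (glue A b z0)).
have eA x : {in A, forall i,
    enum_val (glue A (restrict A x) z0) i = enum_val x i}.
  by apply/restrict_eqP; rewrite restrict_glue.
have eC x y : {in ~: A, forall i,
    enum_val (glue A (restrict A x) z0) i = enum_val (glue A (restrict A y) z0) i}.
  by apply/restrict_eqP; rewrite !restrict_glueC.
apply/matrixP => x y; rewrite !mxE.
have rB w : restrict B (glue A (restrict A w) z0) = restrict B w.
  by apply/restrict_eqP => i /BA; exact: eA.
rewrite !rB -mulrA -natrM mulnb; congr (_ * (nat_of_bool _)%:R).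
(* Agreement outside [B] means agreement on [A] minus [B] together with agreement outside [A]. *)
apply/eqP/andP => [/restrict_eqP h|[/eqP/restrict_eqP h1 /eqP/restrict_eqP h2]].
  split; apply/eqP/restrict_eqP => i iB.
    case iA: (i \in A); first by rewrite !eA // h.
    by apply: eC; rewrite inE iA.
  by apply: h; rewrite inE; apply: contraTN iB => /BA; rewrite inE => ->.
apply/restrict_eqP => i iB; case iA: (i \in A).
  by have := h1 i iB; rewrite !eA.
by apply: h2; rewrite inE iA.
Qed.

Lemma trace_acts_on_marginal A (H M N : op R 'I_n) : acts_on A H ->
  marginal A M = marginal A N -> \tr (H *m M) = \tr (H *m N).
Proof. by move=> [X ->] E; rewrite !trace_tensor_marginal E. Qed.

End Subsystems.

(** * Gibbs states *)

(** The suffixes [t], [p], [s] stand for tau, its image under the channel, and sigma; [S], [h], [b]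
    stand for entropy, energy and boundary energy, and bare [b] for beta. The 4 is 3 from entropy
    continuity plus 1 from the energy error. *)
Lemma mutual_info_arith (R : realDomainType)
    (St Sp Ss b ht hp hs bt bs nB nH eps m : R) :
  0 < b -> St <= Sp + b * (ht - hp) -> Sp - Ss <= 3 * eps * m ->
  ht - hs = bt - bs -> `|bt| <= nB -> `|bs| <= nB -> `|hp - hs| <= nH ->
  b * nH <= m * eps -> St - Ss <= 2 * b * nB + 4 * eps * m.
Proof.
move=> b0 h1 h2 h3; rewrite !ler_norml => /andP[_ h4] /andP[h5 _] /andP[h6 _] h7.
have : b * (ht - hp) <= b * (nB + nB + nH).
  by rewrite ler_pM2l //; lra.
by lra.
Qed.

Lemma subr_exchange (R : realDomainType) (a b c e : R) :
  a - b = c - e -> a - c = b - e.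
Proof. by move=> h; lra. Qed.

Section Gibbs.
Context {R : realType}.
Local Notation C := R[i].

Lemma hermsymmx_adj d (M : 'M[C]_d) : M \is hermsymmx -> M^H = M.
Proof.
by rewrite qualifE /= expr0 scale1r -[X in _ == X]adjmxE => /eqP <-.
Qed.

Lemma adjmx_sum d (I : Type) (r : seq I) (P : pred I) (F : I -> 'M[C]_d) :
  (forall i, P i -> (F i)^H = F i) ->
  (\sum_(i <- r | P i) F i)^H = \sum_(i <- r | P i) F i.
Proof.
move=> h; apply: (big_ind (fun X : 'M[C]_d => X^H = X)) => //.
  by apply/matrixP => i j; rewrite adjmxEij !mxE conjc0.
by move=> X Y hX hY; rewrite adjmxD hX hY.
Qed.

Lemma eigdecZ d (U : 'M[C]_d) p M (a : R) : eigdec U p M ->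
  eigdec U (fun j => a * p j) (a%:C *: M).
Proof.
move=> [Uu ->]; split=> //.
have -> : rdiag (fun j => a * p j) = a%:C *: rdiag p.
  apply/matrixP=> i j; rewrite rdiagE mxE rdiagE rmorphM.
  by case: (i == j); rewrite ?mulr1n ?mulr0n ?mulr0.
by rewrite -scalemxAr -scalemxAl.
Qed.

Lemma eigdec_inj d (U : 'M[C]_d) p q M N : eigdec U p M -> eigdec U q N ->
  p =1 q -> M = N.
Proof.
move=> [_ ->] [_ ->] pq; congr (_ *m diag_mx _ *m _).
by apply/rowP => j; rewrite !mxE pq.
Qed.

(** The Gibbs state has the eigenbasis of [H] with eigenvalues [expR (- beta * l j) / Z]; positive
    dimension gives [0 < Z], and [c] is [ln Z]. *)
Lemma ln_gibbs d (beta : R) (H : 'M[C]_d) : (0 < d)%N -> H^H = H ->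
  posmx (gibbs beta H) /\ \tr (gibbs beta H) = 1 /\
  exists c : R, mxfun (@ln R) (gibbs beta H) =
    (- beta)%:C *: H + ((- c)%:C)%:M.
Proof.
move=> d0 /herm_eigdec[U [l eH]].
have eE := eigdec_mxfun (@expR R) (eigdecZ (- beta) eH).
set E := mxfun _ _ in eE; set Z := \sum_j expR (- beta * l j).
have Z0 : 0 < Z.
  apply: (lt_le_trans (expR_gt0 (- beta * l (Ordinal d0)))).
  by rewrite /Z (bigD1 (Ordinal d0)) //= lerDl sumr_ge0.
have trE : \tr E = Z%:C := trace_eigdecE eE.
have GE : gibbs beta H = (Z^-1)%:C *: E.
  by rewrite /gibbs -/E trE -fmorphV.
have eG := eigdecZ Z^-1 eE; rewrite -GE in eG.
have pG j : 0 < Z^-1 * expR (- beta * l j).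
  by rewrite mulr_gt0 ?invr_gt0 ?expR_gt0.
split; first by exists U, (fun j => Z^-1 * (expR \o (fun j => - beta * l j)) j).
split; first by rewrite GE mxtraceZ trE -rmorphM mulVf ?rmorph1 // gt_eqF.
exists (ln Z); apply: (eigdec_inj (eigdec_mxfun (@ln R) eG)
  (eigdec_affine (- beta) (- ln Z) eH)) => j /=.
by rewrite lnM ?posrE ?invr_gt0 ?expR_gt0 // lnV ?posrE // expRK addrC.
Qed.

(** The constant is chosen before [M], so it cancels between a state and its image under a
    channel. *)
Lemma relent_gibbs d (beta : R) (H : 'M[C]_d) : (0 < d)%N -> H^H = H ->
  exists c : R, forall M, \tr M = 1 ->
    relent M (gibbs beta H) =
    - entropy M + beta * complex.Re (\tr (M *m H)) + c.
Proof.
move=> d0 hH; have [_ [_ [c hc]]] := ln_gibbs beta d0 hH.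
exists c => M tM; rewrite /relent hc mulmxDr mxtraceD -scalemxAr mxtraceZ.
rewrite mul_mx_scalar mxtraceZ tM mulr1 ReD Re_realM /entropy opprK.
by rewrite opprD mulNr opprK addrA /= opprK.
Qed.

Lemma channel_state d (Phi : {linear 'M[C]_d -> 'M[C]_d}) M :
  channel Phi -> state M -> state (Phi M).
Proof. by move=> [cp tr] [hM tM]; split; rewrite ?tr //; exact: cp_psd. Qed.

Lemma entropy_gibbs_channel d (Phi : {linear 'M[C]_d -> 'M[C]_d}) (beta : R) H M :
  (0 < d)%N -> H^H = H -> channel Phi -> Phi (gibbs beta H) = gibbs beta H ->
  state M ->
  entropy M <= entropy (Phi M) + beta * (complex.Re (\tr (M *m H)) -
                                         complex.Re (\tr (Phi M *m H))).
Proof.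
move=> d0 hH ch fixG hM; have [posG _] := ln_gibbs beta d0 hH.
have [c hc] := relent_gibbs beta d0 hH.
have := @relent_channel _ _ Phi M (gibbs beta H) ch hM.1 posG.
rewrite fixG => /(_ posG).
rewrite (hc _ hM.2) (hc _ (channel_state ch hM).2).
by move: (complex.Re _) (complex.Re _) (entropy _) (entropy _); clear=> *; lra.
Qed.

Lemma abs_trace_state_le d (H M : 'M[C]_d) : H^H = H -> state M ->
  `|complex.Re (\tr (M *m H))| <= opnorm H.
Proof.
move=> hH hM; rewrite -[leRHS]mulr1 -(trnorm_state hM).
by apply: abs_trace_le => //; exact: psdmx_herm hM.1.
Qed.

(** * Entropy continuity on qubits *)

Lemma ln2_le1 : ln 2 <= 1 :> R.
Proof. by have := @le_ln1Dx R 1; rewrite -natr1 addrC; apply; lra. Qed.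

Lemma half_lt_le (eps : R) : 2^-1 < eps -> 1 <= 3 * eps.
Proof. by move=> h; lra. Qed.

Lemma half_lt1 (eps : R) : eps <= 2^-1 -> eps / 2 < 1.
Proof. by move=> h; lra. Qed.

(** The first term is at most [eps]; [ln d], [ln 2] and [ln eps^-1] are each at most [m], so the
    second is at most [(3/2) eps m]. As [1 <= m], the sum stays below [3 eps m]. *)
Lemma continuity_bound_le (d n eps m T : R) :
  1 <= d -> ln d <= n -> n <= m -> ln eps^-1 <= m -> 1 <= m ->
  0 < eps -> eps <= 2^-1 -> T <= eps ->
  - ln (1 - eps / 2) + T / 2 * ln (d / (eps / 2)) <= 3 * eps * m.
Proof.
move=> d1 lnd nm lnm m1 eps0 small T_le.
have d0 : 0 < d by exact: lt_le_trans d1.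
have s0 : 0 < eps / 2 by lra.
have b1 : - ln (1 - eps / 2) <= eps.
  have h : 0 < 1 - eps / 2 by lra.
  rewrite -lnV ?posrE //.
  have -> : (1 - eps / 2)^-1 = 1 + eps / 2 / (1 - eps / 2) by field; lra.
  have r0 : 0 < eps / 2 / (1 - eps / 2) by rewrite divr_gt0.
  apply: le_trans (le_ln1Dx _) _; first by lra.
  by rewrite ler_pdivrMr //; nra.
have b2 : ln (d / (eps / 2)) <= 3 * m.
  have -> : d / (eps / 2) = d * (2 * eps^-1) by field; lra.
  rewrite lnM ?posrE ?mulr_gt0 ?invr_gt0 //.
  rewrite lnM ?posrE ?invr_gt0 //.
  by have := ln2_le1; lra.
have b3 : 0 <= ln (d / (eps / 2)).
  by rewrite ln_ge0 // ler_pdivlMr // mul1r; lra.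
have b4 : T / 2 * ln (d / (eps / 2)) <= eps / 2 * (3 * m).
  apply: (@le_trans _ _ (eps / 2 * ln (d / (eps / 2)))).
    by rewrite ler_wpM2r // ler_wpM2r.
  by rewrite ler_wpM2l // ltW.
have b5 : eps <= eps * m by rewrite ler_peMr // ltW.
by move: eps0 b1 b4 b5; move: (ln _) (ln _) => x y; clear; lra.
Qed.

Lemma entropy_diff_le n d (a b : 'M[C]_d) (eps m : R) : d = (2 ^ n)%N ->
  state a -> state b -> 0 < eps -> trnorm (a - b) <= eps ->
  ln eps^-1 <= m -> n%:R <= m -> entropy a - entropy b <= 3 * eps * m.
Proof.
move=> dE ha hb eps0 trle lnm nm.
have d0 : (0 < d)%N by rewrite dE expn_gt0.
have lnd : ln d%:R <= n%:R :> R.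
  by rewrite dE natrX lnXn // -(mulr_natl (ln 2)) ler_piMr ?ln2_le1.
have n0 : 0 <= n%:R :> R by [].
have trivial : entropy a - entropy b <= n%:R.
  rewrite lerBlDr (le_trans (entropy_state_le d0 ha)) //.
  by rewrite (le_trans lnd) // lerDl entropy_state_ge0.
have m0 : 0 <= m by exact: le_trans nm.
(* At [n = 0] the bound [1 <= m] may fail, but the trivial estimate is then 0. *)
have [n_eq0|n_gt0] := posnP n.
  apply: le_trans trivial _; rewrite n_eq0.
  by rewrite !mulr_ge0 // ltW.
have m1 : 1 <= m by apply: le_trans nm; rewrite ler1n.
(* For [eps] above 1/2 the trivial estimate suffices, since [1 <= 3 * eps]; otherwise continuity is
   applied with [s = eps / 2]. *)
have [small|large] := leP eps 2^-1; last first.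
  apply: le_trans trivial _; apply: le_trans nm _.
  by rewrite ler_peMl // half_lt_le.
have s0 : 0 < eps / 2 by rewrite divr_gt0.
have s1 : eps / 2 < 1 by exact: half_lt1.
apply: le_trans (entropy_continuity d0 ha hb s0 s1) _.
by apply: continuity_bound_le lnd nm lnm m1 eps0 small trle; rewrite ler1n.
Qed.

(** A term not crossing the cut acts inside [A] or inside its complement, so its expectation depends
    only on the marginals shared by [M] and [N]. *)
Lemma energy_diff_boundary n (G : finType) (supp : G -> {set 'I_n})
    (h : G -> op R 'I_n) (A : {set 'I_n}) M N :
  local_terms supp h ->
  marginal A M = marginal A N -> marginal (~: A) M = marginal (~: A) N ->
  complex.Re (\tr (M *m hamiltonian h)) - complex.Re (\tr (N *m hamiltonian h)) =
  complex.Re (\tr (M *m boundary supp h A)) -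
  complex.Re (\tr (N *m boundary supp h A)).
Proof.
move=> hloc EA EC.
have E : \tr (M *m hamiltonian h) - \tr (M *m boundary supp h A) =
         \tr (N *m hamiltonian h) - \tr (N *m boundary supp h A).
  set P := fun g => (supp g :&: A != finset.set0) && (supp g :&: ~: A != finset.set0).
  have split (X : op R 'I_n) : \tr (X *m hamiltonian h) -
      \tr (X *m boundary supp h A) = \sum_(g | ~~ P g) \tr (h g *m X).
    rewrite /hamiltonian /boundary (bigID P) /= mulmxDr mxtraceD addrC addKr.
    rewrite mulmx_sumr raddf_sum; apply: eq_bigr => g _; exact: mxtrace_mulC.
  rewrite !split; apply: eq_bigr => g; rewrite /P negb_and !negbK => Pg.
  have [_ act] := hloc g.
  case/orP: Pg => /eqP/setP S.
    apply: trace_acts_on_marginal EC; apply: acts_on_subset act.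
    by apply/fintype.subsetP => i ig; have := S i; rewrite !inE ig /= => ->.
  apply: trace_acts_on_marginal EA; apply: acts_on_subset act.
  apply/fintype.subsetP => i ig; have := S i; rewrite !inE ig /=.
  by move/negbFE.
by have := congr1 (@complex.Re R) E; rewrite !ReB; exact: subr_exchange.
Qed.

End Gibbs.

Theorem mainTheorem4 (R : realType) (n : nat)
    (G : finType) (supp : G -> {set 'I_n}) (h : G -> op R 'I_n)
    (hloc : local_terms supp h)
    (beta : R) (beta_gt0 : 0 < beta)
    (A : {set 'I_n})
    (sigma : op R 'I_n) (sigma_state : state sigma)
    (Phi : {linear op R 'I_n -> op R 'I_n}) (Phi_channel : channel Phi)
    (eps : R) (eps_gt0 : 0 < eps)
    (Phi_markov :
       trnorm (Phi (tensor (marginal A sigma) (marginal (~: A) sigma)) - sigma)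
         <= eps)
    (Phi_gibbs :
       Phi (gibbs beta (hamiltonian h)) = gibbs beta (hamiltonian h)) :
  mutual_info A sigma
    <= 2 * beta * opnorm (boundary supp h A)
       + 4 * eps * Num.max (ln eps^-1)
                     (Num.max (beta * opnorm (hamiltonian h)) n%:R).
Proof.
set dH := boundary supp h A; set H := hamiltonian h in Phi_gibbs *.
have cardE : #|{ffun 'I_n -> bool}| = (2 ^ n)%N.
  by rewrite card_ffun card_bool card_ord.
have d0 : (0 < #|{ffun 'I_n -> bool}|)%N by rewrite cardE expn_gt0.
have hH : H^H = H.
  by apply: adjmx_sum => g _; apply: hermsymmx_adj; case: (hloc g).
have hdH : dH^H = dH.
  by apply: adjmx_sum => g _; apply: hermsymmx_adj; case: (hloc g).
have sA := marginal_state A sigma_state.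
have sC := marginal_state (~: A) sigma_state.
set tau := tensor _ _ in Phi_markov.
have stau : state tau := tensor_state sA sC.
have sPhi := channel_state Phi_channel stau.
(* Additivity on products turns the mutual information into S(tau) - S(sigma). *)
rewrite /mutual_info -(entropy_tensor sA sC) -/tau.
set m := Num.max _ _.
have m1 : ln eps^-1 <= m by rewrite le_max lexx.
have m2 : beta * opnorm H <= m by rewrite !le_max lexx orbT.
have m3 : n%:R <= m by rewrite !le_max lexx !orbT.
(* Data processing trades S(tau) for S(Phi tau) and an energy difference; continuity then compares
   S(Phi tau) with S(sigma). *)
have b1 := entropy_gibbs_channel d0 hH Phi_channel Phi_gibbs stau.
have b2 := entropy_diff_le cardE sPhi sigma_state eps_gt0 Phi_markov m1 m3.
have EA : marginal A tau = marginal A sigma := marginal_tensorl _ sC.2.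
have EC : marginal (~: A) tau = marginal (~: A) sigma := marginal_tensorr _ sA.2.
have b3 := energy_diff_boundary hloc EA EC.
have b4 := abs_trace_state_le hdH stau.
have b5 := abs_trace_state_le hdH sigma_state.
have hdiff : (Phi tau - sigma)^H = Phi tau - sigma.
  by rewrite adjmxD adjmxN (psdmx_herm sPhi.1) (psdmx_herm sigma_state.1).
have b6 := abs_trace_le hH hdiff.
rewrite mulmxBl mxtraceD mxtraceN ReB in b6.
(* The energy error is at most [eps * m], since [beta * opnorm H <= m] and the trace distance is at
   most [eps]. *)
have b7 : beta * (opnorm H * trnorm (Phi tau - sigma)) <= m * eps.
  rewrite mulrA; apply: ler_pM => //.
    by rewrite mulr_ge0 ?opnorm_ge0 // ltW.
  by have [U [l e]] := herm_eigdec hdiff; rewrite (trnorm_eigdec e) sumr_ge0.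
exact: mutual_info_arith beta_gt0 b1 b2 b3 b4 b5 b6 b7.
Qed.
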